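(* Let $\Delta$ be a simplicial polytopal fan in $\mathbb{R}^d$ with ray generators $\mathbf{v}_1,\ldots,\mathbf{v}_n$. Let $\mathbf{u}^{(1)},\mathbf{u}^{(2)},\ldots\in\mathbb{S}^{d-1}$ be a sequence of directions for which there exist $0\le t<1/2$, $\delta>0$ and $N\in\mathbb{N}$ such that \[ |\{\mathbf{u}^{(1)},\ldots,\mathbf{u}^{(m)}\}\cap C_t(i)|\ge m(2.5nt+\delta) \] for all $m\ge N$ and all $1\le i\le n$. Let $P=P(\mathbf{h}_0)\in\mathcal{P}(\Delta)$ and for all $i\ge1$ let $y^{(i)}=h_P(\mathbf{u}^{(i)})+\varepsilon^{(i)}$, where the errors $\varepsilon^{(i)}\sim\mathcal{N}(0,\sigma_i^2)$ are independent with $\sigma_i^2\le\gamma<\infty$. Let $\hat{P}^\Delta_m(U,\mathbf{y})$ denote the least-squares estimate based on the first $m$ data points. Then for all $m\ge N$ the least-squares estimate $\hat{P}^\Delta_m(U,\mathbf{y})$ is unique and \[ \mathbb{P}\big(\lim_{m\to\infty}\hat{P}^\Delta_m(U,\mathbf{y})=P\big)=1 \] (convergence in Hausdorff distance). Moreover, for all $m\ge N$ and every failure probability $\eta\in(0,1)$, \[ \mathbb{P}\left(d_H(\hat{P}^\Delta_m(U,\mathbf{y}),P)\ge\frac{1}{\sqrt m}\frac{n(c^\Delta)^2}{\kappa}\sqrt{2d\gamma\lambda\log\left(\frac{2n}{\eta}\right)}\right)\le\eta, \] where \[ \kappa=\left(\frac{\delta}{\max_i\|\mathbf{v}_i\|^2}\right)^{3/2},\qquad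 \lambda=(c^\Delta)^2-\left((c^\Delta)^2-\frac{t^2}{\min_i\|\mathbf{v}_i\|^2}\right)(n-1)(2.5nt+\delta). \]
   Context: A fan is simplicial if every cone is generated by linearly independent vectors; polytopal if it is the normal fan of a polytope. $h_P(\mathbf{u})=\max_{\mathbf{x}\in P}\langle\mathbf{x},\mathbf{u}\rangle$. For $\mathbf{h}\in\mathbb{R}^n$, $P(\mathbf{h})=\{\mathbf{x}\colon\langle\mathbf{x},\mathbf{v}_i\rangle\le h_i\ \forall i\}$. The deformation cone $\mathcal{P}(\Delta)$ is the set of polytopes whose normal fan is coarsened by $\Delta$, identified via support vectors $\mathbf{h}=(h_P(\mathbf{v}_i))_i$ with a closed polyhedral cone in $\mathbb{R}^n$. For $\mathbf{u}\in\mathbb{R}^d$, with $\sigma$ the cone of $\Delta$ containing $\mathbf{u}$ in its relative interior and $\mathbf{u}=\sum_{k\in I_\sigma}\lambda_k\mathbf{v}_k$ over the generators of $\sigma$, set $[\mathbf{u}]_i=\lambda_i$ for $i\in I_\sigma$ and $0$ otherwise. $c^\Delta=\max_{\mathbf{u}\in\mathbb{S}^{d-1}}\max_i[\mathbf{u}]_i$. $W$ is the $n\times n$ diagonal matrix with diagonal entries $\|\mathbf{v}_1\|,\ldots,\|\mathbf{v}_n\|$, and $C_t(j)=\{\mathbf{x}\in\mathbb{R}^d\colon\|[\mathbf{x}]^\mathsf{T}W-\mathbf{e}_j\|_\infty\le t\}$. With $U=(\mathbf{u}^{(1)},\ldots,\mathbf{u}^{(m)})^\mathsf{T}$ and $\mathbf{y}=(y^{(1)},\ldots,y^{(m)})$,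 $\hat{P}^\Delta_m(U,\mathbf{y})$ is the set of polytopes $Q\in\mathcal{P}(\Delta)$ minimizing $\frac1m\sum_{i=1}^m(h_Q(\mathbf{u}^{(i)})-y^{(i)})^2$. $d_H$ is the Hausdorff distance. *)

(* Defs.v *)
From HB Require Import structures.
From mathcomp Require Import all_boot all_order all_algebra.
From mathcomp Require Import all_classical all_reals all_analysis.
Set Implicit Arguments. Unset Strict Implicit. Unset Printing Implicit Defensive.
Import Order.TTheory GRing.Theory Num.Theory.
Local Open Scope classical_set_scope.
Local Open Scope ring_scope.

Section Geometry.
Variables (R : realType) (d n : nat).
Implicit Types (x y u : 'rV[R]_d) (A B Q : set 'rV[R]_d).

Definition dotp x y : R := \sum_(i < d) x ord0 i * y ord0 i.
Definition enorm x : R := Num.sqrt (dotp x x).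

Definition gcone (v : 'I_n -> 'rV[R]_d) (S : {set 'I_n}) : set 'rV[R]_d :=
  [set x | exists lam : 'I_n -> R, (forall i, 0 <= lam i) /\
     (forall i, i \notin S -> lam i = 0) /\ x = \sum_i lam i *: v i].

Definition conv (k : nat) (p : 'I_k -> 'rV[R]_d) : set 'rV[R]_d :=
  [set x | exists w : 'I_k -> R, (forall j, 0 <= w j) /\ \sum_j w j = 1 /\
     x = \sum_j w j *: p j].

Definition is_polytope Q : Prop := exists k (p : 'I_k.+1 -> 'rV[R]_d), Q = conv p.

Definition face Q u : set 'rV[R]_d :=
  [set x | Q x /\ forall y, Q y -> dotp y u <= dotp x u].

Definition normal_cone Q (F : set 'rV[R]_d) : set 'rV[R]_d :=
  [set u | F `<=` face Q u].

Definition normal_fan Q : set (set 'rV[R]_d) :=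
  [set normal_cone Q (face Q u) | u in [set: 'rV[R]_d]].

Definition simplicial_polytopal_fan (v : 'I_n -> 'rV[R]_d)
    (Delta : {set {set 'I_n}}) : Prop :=
  [/\ exists Q, is_polytope Q /\
        normal_fan Q = [set gcone v S | S in [set S | S \in Delta]],
      (forall S, S \in Delta -> forall lam : 'I_n -> R,
          (forall i, i \notin S -> lam i = 0) ->
          \sum_i lam i *: v i = 0 -> forall i, lam i = 0),
      (forall i, [set i]%SET \in Delta) &
      (forall i j, gcone v [set i]%SET = gcone v [set j]%SET -> i = j)].

(* [u] : coefficients of u in the generators of the cone of Delta containing
   u in its relative interior (0 on the other indices) *)
Definition coord (v : 'I_n -> 'rV[R]_d) (Delta : {set {set 'I_n}}) u
  : 'rV[R]_n :=
  xget 0 [set lam : 'rV[R]_n | (forall i, 0 <= lam ord0 i) /\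
     [set i | lam ord0 i != 0]%SET \in Delta /\ u = \sum_i lam ord0 i *: v i].

Definition cDelta (v : 'I_n -> 'rV[R]_d) (Delta : {set {set 'I_n}}) : R :=
  sup [set r | exists u i, enorm u = 1 /\ r = coord v Delta u ord0 i].

Definition Ct (v : 'I_n -> 'rV[R]_d) (Delta : {set {set 'I_n}}) (t : R)
    (j : 'I_n) : set 'rV[R]_d :=
  [set x | forall i, `| coord v Delta x ord0 i * enorm (v i) - (i == j)%:R | <= t].

Definition hsupp Q u : R := sup [set dotp x u | x in Q].

Definition polyh (v : 'I_n -> 'rV[R]_d) (h : 'I_n -> R) : set 'rV[R]_d :=
  [set x | forall i, dotp x (v i) <= h i].

(* Q belongs to the deformation cone P(Delta): Q is a polytope whose normal
   fan is coarsened by Delta (every cone of Delta lies in a normal cone of Q) *)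
Definition in_defcone (v : 'I_n -> 'rV[R]_d) (Delta : {set {set 'I_n}}) Q
  : Prop :=
  is_polytope Q /\ forall S, S \in Delta ->
    exists C, normal_fan Q C /\ gcone v S `<=` C.

Definition lsq_obj (U : nat -> 'rV[R]_d) (y : nat -> R) (m : nat) Q : R :=
  m%:R^-1 * \sum_(k < m) (hsupp Q (U k) - y k) ^+ 2.

Definition LSE (v : 'I_n -> 'rV[R]_d) (Delta : {set {set 'I_n}})
    (U : nat -> 'rV[R]_d) (y : nat -> R) (m : nat) : set (set 'rV[R]_d) :=
  [set Q | in_defcone v Delta Q /\
     forall Q', in_defcone v Delta Q' -> lsq_obj U y m Q <= lsq_obj U y m Q'].

Definition setdist x A : R := inf [set enorm (x - a) | a in A].
Definition dH A B : R :=
  Num.max (sup [set setdist a B | a in A]) (sup [set setdist b A | b in B]).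

End Geometry.

Definition mutually_independent (R : realType) (dd : measure_display)
    (Omega : measurableType dd) (Pr : probability Omega R)
    (X : nat -> {RV Pr >-> R}) : Prop :=
  forall (s : seq nat) (B : nat -> set R), uniq s ->
    (forall i, measurable (B i)) ->
    Pr (\big[setI/setT]_(i <- s) (X i @^-1` B i)) =
    (\big[*%E/1%E]_(i <- s) Pr (X i @^-1` B i))%E.

(* Main.v *)
Require Import Defs.
From HB Require Import structures.
From mathcomp Require Import all_boot all_order all_algebra.
From mathcomp Require Import all_classical all_reals all_analysis.
From mathcomp Require Import measurable_realfun ring lra.
Set Implicit Arguments. Unset Strict Implicit. Unset Printing Implicit Defensive.
Import Order.TTheory GRing.Theory Num.Theory.
Import numFieldNormedType.Exports.
Local Open Scope classical_set_scope.
Local Open Scope ring_scope.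

(** A polytope [Q] of the deformation cone is determined by the vector [h_Q] of
    its support values at the [v_i], and [h_Q(u) = <[u], h_Q>].  By Farkas' lemma
    the vectors [h_Q] are exactly those for which [u |-> <[u], h>] is sublinear,
    an intersection of half-spaces.  Least squares is thus the projection onto a
    closed convex set for the quadratic form [A^T A], where the rows of [A] are
    the [[u^(k)]].  Directions in [C_t(j)] have [[u]] close to [e_j / |v_j|], and
    the sets [C_t(j)] are disjoint, so the counting hypothesis makes
    [A^T A >= m (delta / max |v_i|^2)], whence existence and uniqueness.  The
    variational inequality bounds [h_Q - h_P] by [A^T eps] divided by that
    constant; the entries of [A^T eps] are centered Gaussians of variance at most
    [gamma m lambda], so Chernoff's bound and a union bound give the rate, and
    Borel-Cantelli the almost sure convergence. *)

(** * Farkas' lemma and polytopes *)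

(** The estimator is a set-valued function of the noise, and its measurability is not established.
    Probabilities are computed only for [large_noise], the event that some entry of [A^T eps]
    reaches a level [s]; off it all estimates are deterministic and strict, so a large Hausdorff
    error lies inside a measurable set of controlled probability. The constant [5/2]: with
    [tau = n t] and [p = 5/2 tau + delta], replacing [[u]] by [e_j / |v_j|] costs a factor
    [1 - 2 tau], and [p (1 - 2 tau) - delta = tau (5/2 - 2 p)] is nonnegative because the disjoint
    [C_t(j)] force [n p <= 1] while a complete fan in positive dimension has at least two rays. The
    exponent [3/2]: with [a = delta / max |v_i|^2] the argument yields the factor [sqrt n c / a];
    the stated [n c^2 / a^(3/2)] is at least as large because [a <= c^2]. [Delta] is only known as a
    family of index sets whose cones form the normal fan of some polytope. That cones overlap
    compatibly, so that [[u]] is well defined, is read off from inclusions between faces of that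
    polytope. *)

Section Dot.
Context {R : realType} {d : nat}.
Implicit Types x y z : 'rV[R]_d.

Lemma dotpC x y : dotp x y = dotp y x.
Proof. by apply: eq_bigr => i _; rewrite mulrC. Qed.

Lemma dotpDl x y z : dotp (x + y) z = dotp x z + dotp y z.
Proof. by rewrite -big_split; apply: eq_bigr => i _; rewrite mxE mulrDl. Qed.

Lemma dotpZl (a : R) x z : dotp (a *: x) z = a * dotp x z.
Proof. by rewrite /dotp mulr_sumr; apply: eq_bigr => i _; rewrite mxE mulrA. Qed.

Lemma dotpDr x y z : dotp z (x + y) = dotp z x + dotp z y.
Proof. by rewrite dotpC dotpDl !(dotpC z). Qed.

Lemma dotpZr (a : R) x z : dotp z (a *: x) = a * dotp z x.
Proof. by rewrite dotpC dotpZl dotpC. Qed.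

Lemma dotpNl x z : dotp (- x) z = - dotp x z.
Proof. by rewrite -scaleN1r dotpZl mulN1r. Qed.

Lemma dotpNr x z : dotp z (- x) = - dotp z x.
Proof. by rewrite -scaleN1r dotpZr mulN1r. Qed.

Lemma dotpBl x y z : dotp (x - y) z = dotp x z - dotp y z.
Proof. by rewrite dotpDl dotpNl. Qed.

Lemma dotpBr x y z : dotp z (x - y) = dotp z x - dotp z y.
Proof. by rewrite dotpDr dotpNr. Qed.

Lemma dotp0l z : dotp 0 z = 0.
Proof. by rewrite -(scale0r z) dotpZl mul0r. Qed.

Lemma dotp0r z : dotp z 0 = 0.
Proof. by rewrite dotpC dotp0l. Qed.

Lemma dotp_sumr (I : Type) (r : seq I) (P : pred I) (F : I -> 'rV[R]_d) z :
  dotp z (\sum_(i <- r | P i) F i) = \sum_(i <- r | P i) dotp z (F i).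
Proof.
by elim/big_rec2: _ => [|i a b _ <-]; rewrite ?dotp0r// dotpDr.
Qed.

Lemma dotp_suml (I : Type) (r : seq I) (P : pred I) (F : I -> 'rV[R]_d) z :
  dotp (\sum_(i <- r | P i) F i) z = \sum_(i <- r | P i) dotp (F i) z.
Proof. by rewrite dotpC dotp_sumr; apply: eq_bigr => i _; rewrite dotpC. Qed.

Lemma dotp_ge0 x : 0 <= dotp x x.
Proof. by apply: sumr_ge0 => i _; rewrite -expr2 sqr_ge0. Qed.

Lemma dotp_eq0 x : dotp x x = 0 -> x = 0.
Proof.
move=> /eqP; rewrite psumr_eq0; last by move=> i _; rewrite -expr2 sqr_ge0.
move=> /allP x0; apply/rowP => i; rewrite mxE; apply/eqP.
have := x0 i; rewrite mem_index_enum => /(_ isT) /=.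
by rewrite mulf_eq0 orbb (_ : ord0 = 0)//; exact: val_inj.
Qed.

Lemma dotp_gt0 x : x != 0 -> 0 < dotp x x.
Proof.
move=> x0; rewrite lt_neqAle dotp_ge0 andbT eq_sym.
by apply: contra x0 => /eqP/dotp_eq0 ->.
Qed.

Lemma enorm_ge0 x : 0 <= enorm x.
Proof. exact: sqrtr_ge0. Qed.

Lemma sqr_enorm x : enorm x ^+ 2 = dotp x x.
Proof. by rewrite sqr_sqrtr// dotp_ge0. Qed.

Lemma enormZ (a : R) x : enorm (a *: x) = `|a| * enorm x.
Proof.
by rewrite /enorm dotpZl dotpZr mulrA -expr2 sqrtrM ?sqr_ge0// sqrtr_sqr.
Qed.

Lemma enorm_gt0 x : x != 0 -> 0 < enorm x.
Proof. by move=> x0; rewrite sqrtr_gt0 dotp_gt0. Qed.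

Lemma CauchySchwarz x y : dotp x y <= enorm x * enorm y.
Proof.
have [->|y0] := eqVneq y 0; first by rewrite dotp0r mulr_ge0 ?enorm_ge0.
apply: (le_trans (ler_norm _)).
rewrite -ler_sqr ?nnegrE ?mulr_ge0 ?enorm_ge0 ?normr_ge0//.
rewrite real_normK ?num_real// exprMn !sqr_enorm.
have := dotp_ge0 (dotp y y *: x - dotp x y *: y).
rewrite !(dotpBl, dotpBr, dotpZl, dotpZr) (dotpC y x) => H.
have Y := dotp_gt0 y0.
rewrite -(@ler_pM2l _ (dotp y y))// -subr_ge0.
by apply: le_trans H _; rewrite le_eqVlt; apply/orP; left; apply/eqP; ring.
Qed.

End Dot.

Section Farkas.
Context {R : realType}.

(* Induction on the number of generators: if [y] separates [b] from the first
   [k] of them but fails on the last one, project along the last generator onto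
   the hyperplane orthogonal to [y]. *)
Lemma farkas_ord {m : nat} (k : nat) (a : 'I_k -> 'rV[R]_m) (b : 'rV[R]_m) :
  (exists lam : 'I_k -> R, (forall i, 0 <= lam i) /\
     b = \sum_i lam i *: a i) \/
  (exists y, (forall i, 0 <= dotp y (a i)) /\ dotp y b < 0).
Proof.
elim: k a b => [a b|k IH a b].
  have [->|b0] := eqVneq b 0.
    by left; exists (fun=> 0); split=> //; rewrite big_ord0.
  by right; exists (- b); split=> [[]//|]; rewrite dotpNl oppr_lt0 dotp_gt0.
set a' := fun i => a (lift ord0 i); set a0 := a ord0.
pose ext (c : R) (l : 'I_k -> R) := fun i => if unlift ord0 i is Some j then l j else c.
have extE c l : \sum_i ext c l i *: a i = c *: a0 + \sum_i l i *: a' i.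
  rewrite big_ord_recl /ext unlift_none; congr (_ + _).
  by apply: eq_bigr => i _; rewrite liftK.
have ext_ge0 c l : 0 <= c -> (forall i, 0 <= l i) -> forall i, 0 <= ext c l i.
  by move=> c0 l0 i; rewrite /ext; case: unliftP.
have [[l [l0 ->]]|[y [ya yb]]] := IH a' b.
  left; exists (ext 0 l); split; first exact: ext_ge0.
  by rewrite extE scale0r add0r.
have [ya0|ya0] := leP 0 (dotp y a0).
  right; exists y; split=> // i.
  by have [j ->|->] := unliftP ord0 i; [exact: ya|exact: ya0].
pose r z := dotp y z / dotp y a0.
have [[l [l0 E]]|[z [za zb]]] := IH (fun i => a' i - r (a' i) *: a0) (b - r b *: a0).
  left; exists (ext (r b - \sum_i l i * r (a' i)) l); split.
    apply: ext_ge0 => //; rewrite subr_ge0 (@le_trans _ _ 0)//.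
      apply: sumr_le0 => i _; rewrite mulr_ge0_le0// /r.
      by rewrite mulr_ge0_le0// ?ya// invr_le0 ltW.
    by rewrite /r mulr_le0// ?invr_le0 ltW.
  rewrite extE scalerBl scaler_suml addrAC -addrA -sumrB.
  rewrite -[LHS](subrK (r b *: a0)) E addrC; congr (_ + _).
  by apply: eq_bigr => i _; rewrite scalerBr scalerA.
right; exists (z - (dotp z a0 / dotp y a0) *: y).
have E x : dotp (z - (dotp z a0 / dotp y a0) *: y) x = dotp z (x - r x *: a0).
  by rewrite dotpBl dotpBr dotpZl dotpZr /r; field; rewrite lt_eqF.
split=> [i|]; last by rewrite E.
have [j ->|->] := unliftP ord0 i; first by rewrite E; exact: za.
rewrite E /r -/a0 divff ?lt_eqF// scale1r subrr dotp0r//.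
Qed.

Lemma farkas {m : nat} (I : finType) (a : I -> 'rV[R]_m) (b : 'rV[R]_m) :
  (exists lam : I -> R, (forall i, 0 <= lam i) /\ b = \sum_i lam i *: a i) \/
  (exists y, (forall i, 0 <= dotp y (a i)) /\ dotp y b < 0).
Proof.
have [[l [l0 ->]]|[y [ya yb]]] := farkas_ord (fun j : 'I_#|I| => a (enum_val j)) b.
  left; exists (fun i => l (enum_rank i)); split=> //.
  rewrite (reindex _ (onW_bij _ (@enum_val_bij I)))/=.
  by apply: eq_bigr => j _; rewrite enum_valK.
right; exists y; split=> // i.
by have := ya (enum_rank i); rewrite enum_rankK.
Qed.

Lemma dotp_row_mx {m1 m2 : nat} (x1 y1 : 'rV[R]_m1) (x2 y2 : 'rV[R]_m2) :
  dotp (row_mx x1 x2) (row_mx y1 y2) = dotp x1 y1 + dotp x2 y2.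
Proof.
rewrite /dotp big_split_ord/=; congr (_ + _); apply: eq_bigr => i _.
  by rewrite !row_mxEl.
by rewrite !row_mxEr.
Qed.

Lemma dotp_scalar (a b : R) : dotp (a%:M : 'rV[R]_1) b%:M = a * b.
Proof. by rewrite /dotp big_ord1 !mxE eqxx !mulr1n. Qed.

Lemma row_mx_scalar {m : nat} (y : 'rV[R]_(m + 1)) :
  exists (z : 'rV[R]_m) (s : R), y = row_mx z s%:M.
Proof.
by exists (lsubmx y), (rsubmx y ord0 ord0); rewrite -mx11_scalar hsubmxK.
Qed.

Lemma sum_row_mx_scalar {m : nat} (I : finType) (l : I -> R)
    (a : I -> 'rV[R]_m) (b : I -> R) :
  \sum_i l i *: row_mx (a i) (b i)%:M =
  row_mx (\sum_i l i *: a i) (\sum_i l i * b i)%:M.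
Proof.
elim/big_rec3: _ => [|i x y z _ ->]; first by rewrite raddf0 row_mx0.
by rewrite scale_row_mx add_row_mx scale_scalar_mx raddfD.
Qed.

(** Homogenization: Farkas is applied to the rows [(a i, b i)] and the target [(0, -1)]. A
    separating vector [(z, s)] has [s > 0], and [- z / s] solves the system. *)
Lemma farkas_affine {m : nat} (I : finType) (a : I -> 'rV[R]_m) (b : I -> R) :
  (exists x, forall i, dotp x (a i) <= b i) \/
  (exists lam : I -> R, (forall i, 0 <= lam i) /\
     \sum_i lam i *: a i = 0 /\ \sum_i lam i * b i < 0).
Proof.
have [[l [l0]]|[y [ya yb]]] :=
    farkas (fun i => row_mx (a i) (b i)%:M) (row_mx 0 (-1)%:M).
  rewrite sum_row_mx_scalar => /eq_row_mx[E1 /(congr1 (fun M : 'rV[R]_1 => M ord0 ord0))].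
  rewrite !mxE eqxx !mulr1n => E2.
  by right; exists l; split=> //; split=> //; rewrite -E2 ltrN10.
have [z [s ?]] := row_mx_scalar y; subst y.
move: yb; rewrite dotp_row_mx dotp_scalar dotp0r add0r mulrN1 oppr_lt0 => s0.
left; exists (- s^-1 *: z) => i; have := ya i.
rewrite dotp_row_mx dotp_scalar dotpZl => H.
have : 0 <= s^-1 * (dotp z (a i) + s * b i) by rewrite mulr_ge0 ?invr_ge0 ?(ltW s0).
by rewrite mulrDr mulKf ?gt_eqF// mulNr; lra.
Qed.

End Farkas.

(** * Support functions and faces of polytopes *)

Section Polytope.
Context {R : realType} {d : nat}.
Implicit Types (x y u : 'rV[R]_d) (Q : set 'rV[R]_d).

Lemma conv_vertex {k : nat} (p : 'I_k -> 'rV[R]_d) j : Defs.conv p (p j).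
Proof.
exists (fun i => (i == j)%:R); split; first by move=> i; rewrite ler0n.
split.
  by rewrite (bigD1 j)//= eqxx big1 ?addr0// => i /negPf ->.
by rewrite (bigD1 j)//= eqxx scale1r big1 ?addr0// => i /negPf ->; rewrite scale0r.
Qed.

Lemma conv_dotp_le {k : nat} (p : 'I_k -> 'rV[R]_d) u (s : R) x :
  (forall j, dotp (p j) u <= s) -> Defs.conv p x -> dotp x u <= s.
Proof.
move=> ps [w [w0 [w1 ->]]]; rewrite dotp_suml -(mul1r s) -w1 mulr_suml.
by apply: ler_sum => j _; rewrite dotpZl ler_wpM2l.
Qed.

Lemma polytope_hsupp Q u : is_polytope Q ->
  exists x, [/\ Q x, hsupp Q u = dotp x u & forall y, Q y -> dotp y u <= dotp x u].
Proof.
move=> [k [p ->]].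
have [j _ pj] := @Order.TotalTheory.arg_maxP _ _ _ (ord0 : 'I_k.+1) xpredT (fun i => dotp (p i) u) isT.
have ub y : Defs.conv p y -> dotp y u <= dotp (p j) u.
  by apply: conv_dotp_le => i; exact: pj.
exists (p j); split=> //; first exact: conv_vertex.
have pju : [set dotp x u | x in Defs.conv p] (dotp (p j) u).
  by exists (p j) => //; exact: conv_vertex.
apply/eqP; rewrite eq_le; apply/andP; split.
  by apply: ge_sup; [exists (dotp (p j) u)|move=> _ [y /ub ? <-]].
by apply: ub_le_sup => //; exists (dotp (p j) u) => _ [y /ub ? <-].
Qed.

Lemma hsupp_ge Q u x : is_polytope Q -> Q x -> dotp x u <= hsupp Q u.
Proof. by move=> /(polytope_hsupp u)[y [_ -> +]] => /[apply]. Qed.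

Lemma hsupp_max Q u x : is_polytope Q -> Q x ->
  (forall y, Q y -> dotp y u <= dotp x u) -> hsupp Q u = dotp x u.
Proof.
move=> Qp Qx xu; apply/eqP; rewrite eq_le hsupp_ge// andbT.
by have [y [Qy -> _]] := polytope_hsupp u Qp; exact: xu.
Qed.

(** Farkas for the lifted points [(p j, 1)] and [(x, 1)]: the last coordinate turns conic
    combinations into convex ones, and a separating [(z, s)] would make [- z] a direction in which
    [x] exceeds the support value. *)
Lemma polytope_support Q x : is_polytope Q ->
  (forall u, dotp x u <= hsupp Q u) -> Q x.
Proof.
move=> Qp xQ; have [k [p E]] := Qp.
have [[l [l0]]|[y [ya yb]]] :=
    farkas (fun j => row_mx (p j) 1%:M) (row_mx x 1%:M).
  rewrite sum_row_mx_scalar => /eq_row_mx[E1 /(congr1 (fun M : 'rV[R]_1 => M ord0 ord0))].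
  rewrite !mxE eqxx !mulr1n => E2; rewrite E; exists l; split=> //; split=> //.
  by rewrite E2; apply: eq_bigr => i _; rewrite mulr1.
have [z [s ?]] := row_mx_scalar y; subst y.
move: yb; rewrite dotp_row_mx dotp_scalar mulr1 => zx.
have := xQ (- z); have [y [Qy -> _]] := polytope_hsupp (- z) Qp.
have : dotp y (- z) <= s.
  rewrite E in Qy; apply: conv_dotp_le Qy => j; have := ya j.
  by rewrite dotp_row_mx dotp_scalar mulr1 dotpNr (dotpC z); lra.
by rewrite !dotpNr (dotpC x); lra.
Qed.

Lemma uniform_small (I : finType) (g b : I -> R) : (forall i, 0 < g i) ->
  exists2 e : R, 0 < e & forall i, e * b i <= g i.
Proof.
move=> g0; have S0 i : 0 <= `|b i| / g i by rewrite divr_ge0// ltW.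
have T0 : 0 < 1 + \sum_i `|b i| / g i.
  by rewrite ltr_pwDl// sumr_ge0.
exists (1 + \sum_i `|b i| / g i)^-1; first by rewrite invr_gt0.
move=> i; rewrite mulrC ler_pdivrMr//.
have : `|b i| / g i <= 1 + \sum_i `|b i| / g i.
  rewrite (bigD1 i)//= addrCA lerDl addr_ge0// sumr_ge0//.
rewrite ler_pdivrMr// mulrC; apply: le_trans; exact: ler_norm.
Qed.

(** Tilting against [z] moves all points of the face equally, and the finitely many [p j] off the
    face have a positive gap that a small [e] does not exhaust. *)
Lemma face_perturb Q u z : is_polytope Q ->
  (forall x y, face Q u x -> face Q u y -> dotp x z = dotp y z) ->
  exists2 e : R, 0 < e & face Q u `<=` face Q (u - e *: z).
Proof.
move=> Qp cz; have [k [p E]] := Qp.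
have [x0 [Qx0 _ x0m]] := polytope_hsupp u Qp.
have Fx0 : face Q u x0 by [].
have pQ j : Q (p j) by rewrite E; exact: conv_vertex.
(* The value 1 on points of the face is a placeholder keeping [g] positive; those points are treated
   separately below. *)
pose g j := if dotp (p j) u == dotp x0 u then 1 else dotp x0 u - dotp (p j) u.
have g0 j : 0 < g j.
  rewrite /g; case: ifPn => // ne; rewrite subr_gt0 lt_neqAle ne/=.
  exact: x0m.
have [e e0 eb] := uniform_small (fun j => dotp x0 z - dotp (p j) z) g0.
exists e => // x Fx; split; first by case: Fx.
move=> y Qy.
have -> : dotp x (u - e *: z) = dotp x0 (u - e *: z).
  rewrite !dotpBr !dotpZr (cz _ _ Fx Fx0); congr (_ - _).
  by case: Fx => Qx xm; apply/eqP; rewrite eq_le x0m//= xm.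
rewrite E in Qy; apply: conv_dotp_le Qy => j.
have := eb j; rewrite /g !dotpBr !dotpZr; case: ifPn => [/eqP pju _|_]; last lra.
have Fj : face Q u (p j).
  by split=> // q Qq; rewrite pju; exact: x0m.
by rewrite (cz _ _ Fj Fx0) pju.
Qed.

End Polytope.

Section Farkas_equalities.
Context {R : realType}.

(* Farkas with each index carrying two inequalities, the second one reversed and
   only imposed on [S]. *)
Lemma farkas_equality {m n : nat} (v : 'I_n -> 'rV[R]_m) (h : 'I_n -> R)
    (S : {set 'I_n}) :
  (exists x, (forall i, dotp x (v i) <= h i) /\
     forall i, i \in S -> dotp x (v i) = h i) \/
  (exists lam mu : 'I_n -> R, [/\ forall i, 0 <= lam i, forall i, 0 <= mu i,
     forall i, i \notin S -> mu i = 0,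
     \sum_i lam i *: v i = \sum_i mu i *: v i &
     \sum_i lam i * h i < \sum_i mu i * h i]).
Proof.
pose a (p : 'I_n * bool) := if p.2 then (if p.1 \in S then - v p.1 else 0) else v p.1.
pose b (p : 'I_n * bool) := if p.2 then (if p.1 \in S then - h p.1 else 0) else h p.1.
have [[x xab]|[l [l0 [la lb]]]] := farkas_affine a b.
  left; exists x; split=> [i|i iS]; first exact: xab (i, false).
  have := xab (i, true); have := xab (i, false).
  by rewrite /a /b/= iS dotpNr lerN2 => ? ?; apply/eqP; rewrite eq_le; apply/andP.
right; exists (fun i => l (i, false)), (fun i => if i \in S then l (i, true) else 0).
have spl (V : lmodType R) (F : 'I_n * bool -> V) :
    \sum_p F p = \sum_i F (i, false) + \sum_i F (i, true).
  rewrite -big_split/= [RHS](eq_bigr (fun i => \sum_(c : bool) F (i, c))).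
    by rewrite pair_bigA/=; apply: eq_bigr => -[].
  by move=> i _; rewrite big_bool/= addrC.
split=> //; first by move=> i; case: ifP.
- by move=> i /negPf ->.
- apply/eqP; rewrite -subr_eq0 -sumrN -[X in _ == X]la spl/=; apply/eqP.
  congr (_ + _); apply: eq_bigr => i _; rewrite /a/=.
  by case: ifP; rewrite ?scalerN// scale0r scaler0 oppr0.
- rewrite -subr_lt0 -sumrN; apply: le_lt_trans lb; rewrite (spl R^o)/= le_eqVlt.
  apply/orP; left; apply/eqP; congr (_ + _); apply: eq_bigr => i _; rewrite /b/=.
  by case: ifP; rewrite ?mulrN// mul0r mulr0 oppr0.
Qed.

End Farkas_equalities.

(** * Coordinates in a simplicial polytopal fan *)

Section NormalFan.
Context {R : realType} {d n : nat} (v : 'I_n -> 'rV[R]_d) (Delta : {set {set 'I_n}}).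
Context (Q : set 'rV[R]_d) (Qpoly : is_polytope Q).
Context (Qfan : normal_fan Q = [set gcone v S | S in [set S | S \in Delta]]).
Context (indep : forall S, S \in Delta -> forall lam : 'I_n -> R,
  (forall i, i \notin S -> lam i = 0) ->
  \sum_i lam i *: v i = 0 -> forall i, lam i = 0).
Context (rays : forall i, [set i]%SET \in Delta).
Context (rays_inj : forall i j, gcone v [set i]%SET = gcone v [set j]%SET -> i = j).
Implicit Types (S T : {set 'I_n}) (l : 'I_n -> R).

Lemma gcone_generator S i : i \in S -> gcone v S (v i).
Proof.
move=> iS; exists (fun j => (j == i)%:R); split; first by move=> j; rewrite ler0n.
split; first by move=> j jS; case: eqP => // ji; rewrite ji iS in jS.
by rewrite (bigD1 i)//= eqxx scale1r big1 ?addr0// => j /negPf ->; rewrite scale0r.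
Qed.

Lemma cone_normal S : S \in Delta ->
  exists2 w, gcone v S = normal_cone Q (face Q w) & exists x, face Q w x.
Proof.
move=> SD; have : normal_fan Q (gcone v S) by rewrite Qfan; exists S.
move=> [w _ E]; exists w => //.
by have [x [Qx _ xm]] := polytope_hsupp w Qpoly; exists x.
Qed.

Lemma normal_cone_gcone u : exists2 S, S \in Delta & gcone v S = normal_cone Q (face Q u).
Proof.
have : normal_fan Q (normal_cone Q (face Q u)) by exists u.
by rewrite Qfan => -[S SD E]; exists S.
Qed.

(** All generators of [S] are maximized together at some [x0]. A maximizer [x] of the combination
    loses a nonnegative amount against [x0] in each term, and the losses sum to at most 0, so the
    loss at [j] vanishes. *)
Lemma face_generator S l j : S \in Delta -> (forall i, 0 <= l i) ->
  (forall i, i \notin S -> l i = 0) -> 0 < l j ->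
  face Q (\sum_i l i *: v i) `<=` face Q (v j).
Proof.
move=> SD l0 lS lj x [Qx xm]; have [w E [x0 Fx0]] := cone_normal SD.
have x0v i : i \in S -> face Q (v i) x0.
  by move=> /gcone_generator; rewrite E; exact.
have jS : j \in S by apply: contraTT lj => /lS ->; rewrite ltxx.
have term i : 0 <= l i * (dotp x0 (v i) - dotp x (v i)).
  have [/x0v [_ x0m]|/lS ->] := boolP (i \in S); last by rewrite mul0r.
  by rewrite mulr_ge0// subr_ge0; exact: x0m.
have : \sum_i l i * (dotp x0 (v i) - dotp x (v i)) <= 0.
  have := xm _ (proj1 Fx0); rewrite -subr_le0 -dotpBl dotp_sumr => H.
  by apply: le_trans H; apply: ler_sum => i _; rewrite dotpZr dotpBl.
rewrite (bigD1 j)//= => H.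
have H' : l j * (dotp x0 (v j) - dotp x (v j)) <= 0.
  by apply: le_trans H; rewrite lerDl sumr_ge0.
rewrite pmulr_rle0// subr_le0 in H'.
by split=> // y Qy; apply: le_trans H'; exact: (x0v _ jS).2.
Qed.

Lemma normal_cone_anti (F G : set 'rV[R]_d) : F `<=` G -> normal_cone Q G `<=` normal_cone Q F.
Proof. by move=> FG u Gu x /FG/Gu. Qed.

Lemma normal_cone_ray i : normal_cone Q (face Q (v i)) `<=` gcone v [set i]%SET.
Proof.
have [w E _] := cone_normal (rays i); rewrite E; apply: normal_cone_anti.
by have := gcone_generator (finset.set11 i); rewrite E.
Qed.

Lemma generator_neq0 i : v i != 0.
Proof.
apply/eqP => vi0; have H := indep (rays i) (lam := fun j => (j == i)%:R).
suff : (i == i)%:R = 0 :> R by rewrite eqxx => /eqP; rewrite oner_eq0.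
apply: H => [j|]; first by rewrite finset.inE => /negPf ->.
by rewrite big1// => j _; case: eqP => [->|]; rewrite ?vi0 ?scaler0// scale0r.
Qed.

Lemma gcone1 i x : gcone v [set i]%SET x <-> exists2 c, 0 <= c & x = c *: v i.
Proof.
split=> [[l [l0 [ls ->]]]|[c c0 ->]].
  exists (l i) => //; rewrite (bigD1 i)//= big1 ?addr0// => j ji.
  by rewrite ls ?scale0r// finset.inE.
exists (fun j => if j == i then c else 0); split; first by move=> j; case: eqP.
split; first by move=> j; rewrite finset.inE => /negPf ->.
by rewrite (bigD1 i)//= eqxx big1 ?addr0// => j /negPf ->; rewrite scale0r.
Qed.

Lemma generator_multiple i j (c : R) : 0 <= c -> v j = c *: v i -> i = j.
Proof.
move=> c0 E; have c1 : 0 < c.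
  rewrite lt_neqAle c0 andbT eq_sym; apply: contraNneq (generator_neq0 j) => c00.
  by rewrite E c00 scale0r.
apply: rays_inj; apply/seteqP; split=> x /gcone1[b b0 ->]; apply/gcone1.
  exists (b / c); first by rewrite divr_ge0.
  by rewrite E scalerA divfK ?gt_eqF.
by exists (b * c); rewrite ?mulr_ge0// E scalerA.
Qed.

(** If [l i > 0], face inclusions put [v i] in the cone of [T]. Any [v j] used in expanding [v i]
    over [T] has a face containing that of [v i], hence lies on the ray of [v i], and distinct rays
    force [j = i]. *)
Lemma cone_support_sub S T l m : S \in Delta -> T \in Delta ->
  (forall i, 0 <= l i) -> (forall i, i \notin S -> l i = 0) ->
  (forall i, 0 <= m i) -> (forall i, i \notin T -> m i = 0) ->
  \sum_i l i *: v i = \sum_i m i *: v i -> forall i, i \notin T -> l i = 0.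
Proof.
move=> SD TD l0 lS m0 mT E i; apply: contraNeq => li.
have {}li : 0 < l i by rewrite lt_neqAle eq_sym li l0.
have : gcone v T (v i).
  have [w ET _] := cone_normal TD; rewrite ET => x Fx.
  apply: (face_generator SD l0 lS li); rewrite E.
  have : gcone v T (\sum_i m i *: v i) by exists m.
  by rewrite ET; exact.
move=> [b [b0 [bT Ei]]].
have [j bj] : exists j, 0 < b j.
  apply: contrapT => /forallNP nb; have := generator_neq0 i.
  rewrite Ei big1 ?eqxx// => j _.
  suff -> : b j = 0 by rewrite scale0r.
  by apply/eqP; have := nb j; rewrite lt_neqAle b0 andbT eq_sym => /negP; rewrite negbK.
have jT : j \in T by apply: contraTT bj => /bT ->; rewrite ltxx.
have : gcone v [set i]%SET (v j).
  apply: normal_cone_ray => x; rewrite {1}Ei.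
  exact: (face_generator TD b0 bT bj).
by move=> /gcone1[c c0 /(generator_multiple c0) ->].
Qed.

Lemma cone_coef_unique S T l m : S \in Delta -> T \in Delta ->
  (forall i, 0 <= l i) -> (forall i, i \notin S -> l i = 0) ->
  (forall i, 0 <= m i) -> (forall i, i \notin T -> m i = 0) ->
  \sum_i l i *: v i = \sum_i m i *: v i -> l =1 m.
Proof.
move=> SD TD l0 lS m0 mT E i; apply/eqP; rewrite -subr_eq0; apply/eqP.
have lT := cone_support_sub SD TD l0 lS m0 mT E.
apply: (indep TD (lam := fun i => l i - m i)) => [k kT|].
  by rewrite lT// mT// subrr.
by under eq_bigr do rewrite scalerBl; rewrite sumrB E subrr.
Qed.

(* If a coefficient on the minimal cone vanished, tilting [u] slightly away from
   the corresponding generator would stay in that cone. *)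
Lemma coord_exists u : exists lam : 'rV[R]_n, [/\ forall i, 0 <= lam ord0 i,
  [set i | lam ord0 i != 0]%SET \in Delta & u = \sum_i lam ord0 i *: v i].
Proof.
have [S SD E] := normal_cone_gcone u.
have : gcone v S u by rewrite E.
move=> [l [l0 [lS Eu]]].
suff lpos i : i \in S -> 0 < l i.
  exists (\row_i l i); split=> [i||]; first by rewrite mxE.
    rewrite (_ : [set i | _]%SET = S)//; apply/setP => i; rewrite finset.inE mxE.
    by have [/lpos/gt_eqF ->//|/lS ->] := boolP (i \in S); rewrite eqxx.
  by rewrite {1}Eu; apply: eq_bigr => i _; rewrite mxE.
move=> iS; have Fv : face Q u `<=` face Q (v i).
  by have := gcone_generator iS; rewrite E.
have cv x y : face Q u x -> face Q u y -> dotp x (v i) = dotp y (v i).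
  move=> /Fv [Qx xm] /Fv [Qy ym].
  by apply/eqP; rewrite eq_le xm// ym.
have [e e0 Fe] := face_perturb Qpoly cv.
have : gcone v S (u - e *: v i) by rewrite E.
move=> [m [m0 [mS Em]]].
(* By independence the [i]-th coefficient of [u - e *: v i] is [l i - e]; its nonnegativity gives
   [l i >= e > 0]. *)
have H := indep SD (lam := fun j => l j - e * (j == i)%:R - m j).
have : l i - e * (i == i)%:R - m i = 0.
  apply: H => [j jS|].
    have /negPf -> : j != i by apply: contraNneq jS => ->.
    by rewrite lS// mS// mulr0 !subr0.
  under eq_bigr do rewrite !scalerBl; rewrite !sumrB -Eu -Em.
  rewrite (bigD1 i)//= eqxx mulr1 big1 ?addr0 ?subrr// => j /negPf ->.
  by rewrite mulr0 scale0r.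
by rewrite eqxx mulr1; have := m0 i; lra.
Qed.

End NormalFan.

(** * Support vectors of the deformation cone *)

Section Fan.
Context {R : realType} {d n : nat} (v : 'I_n -> 'rV[R]_d) (Delta : {set {set 'I_n}}).
Context (fanP : simplicial_polytopal_fan v Delta).
Local Notation coord := (Defs.coord v Delta).
Implicit Types (u x : 'rV[R]_d) (h : 'rV[R]_n).

Lemma coordP u : [/\ forall i, 0 <= coord u ord0 i,
  [set i | coord u ord0 i != 0]%SET \in Delta & u = \sum_i coord u ord0 i *: v i].
Proof.
have [[Q [Qp Qf]] ind r rinj] := fanP.
have [l [l0 lD lu]] := coord_exists Qp Qf ind u.
have : [set lam : 'rV[R]_n | (forall i, 0 <= lam ord0 i) /\
     [set i | lam ord0 i != 0]%SET \in Delta /\ u = \sum_i lam ord0 i *: v i] l by [].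
by move=> /(ex_intro _ l)/(xgetPex 0)[? []].
Qed.

Lemma coordE u S (lam : 'I_n -> R) : S \in Delta -> (forall i, 0 <= lam i) ->
  (forall i, i \notin S -> lam i = 0) -> u = \sum_i lam i *: v i ->
  forall i, coord u ord0 i = lam i.
Proof.
have [[Q [Qp Qf]] ind r rinj] := fanP; have [c0 cD cu] := coordP u.
move=> SD l0 lS E; apply: (cone_coef_unique Qp Qf ind r rinj cD SD) => //.
  by move=> i; rewrite finset.inE negbK => /eqP.
by rewrite -cu.
Qed.

Lemma coordZ (a : R) u : 0 <= a -> coord (a *: u) = a *: coord u.
Proof.
move=> a0; have [c0 cD cu] := coordP u; apply/rowP => i; rewrite mxE.
apply: (coordE (lam := fun k => a * coord u ord0 k) cD) => [j|j|].
- by rewrite mulr_ge0.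
- by rewrite finset.inE negbK => /eqP ->; rewrite mulr0.
- by rewrite {1}cu scaler_sumr; apply: eq_bigr => j _; rewrite scalerA.
Qed.

Lemma coord_gcone u S (lam : 'I_n -> R) : S \in Delta -> (forall i, 0 <= lam i) ->
  (forall i, i \notin S -> lam i = 0) -> u = \sum_i lam i *: v i ->
  coord u = \row_i lam i.
Proof. by move=> SD l0 lS E; apply/rowP => i; rewrite mxE; exact: (coordE SD l0 lS E). Qed.

Lemma coord_generator i j : coord (v i) ord0 j = (j == i)%:R.
Proof.
have [_ _ r _] := fanP.
rewrite (coordE (r i) (lam := fun j => (j == i)%:R)) => [//|k|k|].
- exact: ler0n.
- by rewrite finset.inE => /negPf ->.
- by rewrite (bigD1 i)//= eqxx scale1r big1 ?addr0// => k /negPf ->; rewrite scale0r.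
Qed.

Lemma coord0 : coord 0 = 0.
Proof. by rewrite -(scale0r 0) coordZ// scale0r. Qed.

Lemma fan_generator_neq0 i : v i != 0.
Proof. by have [_ ind r _] := fanP; exact: (generator_neq0 ind r). Qed.

(** The cone of [S] sits inside one normal cone of [Q], so any point of the corresponding face
    maximizes all its generators at once. *)
Lemma defcone_vertex Q S : in_defcone v Delta Q -> S \in Delta ->
  exists2 x, Q x & forall i, i \in S -> dotp x (v i) = hsupp Q (v i).
Proof.
move=> [Qp QD] /QD [_ [[w _ <-]] SC].
have [x [Qx _ xm]] := polytope_hsupp w Qp; exists x => // i iS.
have /SC Fv := gcone_generator v iS.
have [_ xv] : face Q (v i) x by exact: Fv.
by apply/esym/hsupp_max.
Qed.

Lemma defcone_hsupp Q u : in_defcone v Delta Q ->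
  hsupp Q u = dotp (coord u) (\row_i hsupp Q (v i)).
Proof.
move=> QD; have [c0 cD cu] := coordP u; have [x Qx xv] := defcone_vertex QD cD.
have E y : dotp y u = \sum_i coord u ord0 i * dotp y (v i).
  by rewrite {1}cu dotp_sumr; apply: eq_bigr => i _; rewrite dotpZr.
have xu : dotp x u = dotp (coord u) (\row_i hsupp Q (v i)).
  rewrite E; apply: eq_bigr => i _; rewrite mxE.
  have [->|ci] := eqVneq (coord u ord0 i) 0; first by rewrite !mul0r.
  by rewrite xv// finset.inE.
rewrite -xu; apply: hsupp_max => //; first exact: QD.1.
move=> y Qy; rewrite xu E; apply: ler_sum => i _; rewrite mxE ler_wpM2l//.
by apply: hsupp_ge => //; exact: QD.1.
Qed.

Lemma defcone_inj Q Q' : in_defcone v Delta Q -> in_defcone v Delta Q' ->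
  (forall i, hsupp Q (v i) = hsupp Q' (v i)) -> Q = Q'.
Proof.
wlog suff sub : Q Q' / in_defcone v Delta Q -> in_defcone v Delta Q' ->
    (forall i, hsupp Q (v i) = hsupp Q' (v i)) -> Q `<=` Q'.
  by move=> QD QD' E; apply/seteqP; split; apply: sub.
move=> QD QD' E x Qx; apply: polytope_support; first exact: QD'.1.
move=> u; rewrite (defcone_hsupp u QD').
rewrite (_ : (\row_i _) = \row_i hsupp Q (v i)); last by apply/rowP => i; rewrite !mxE E.
by rewrite -defcone_hsupp//; apply: hsupp_ge => //; exact: QD.1.
Qed.

Lemma hsuppD_le Q u w : is_polytope Q -> hsupp Q (u + w) <= hsupp Q u + hsupp Q w.
Proof.
move=> Qp; have [x [Qx -> _]] := polytope_hsupp (u + w) Qp.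
by rewrite dotpDr lerD// hsupp_ge.
Qed.

(** The support of [lam] need not be a cone of [Delta]; this generality is what refutes the Farkas
    alternative in [defcone_realize]. *)
Lemma coord_sublinear_sum h : (forall u w,
    dotp (coord (u + w)) h <= dotp (coord u) h + dotp (coord w) h) ->
  forall lam : 'I_n -> R, (forall i, 0 <= lam i) ->
  dotp (coord (\sum_i lam i *: v i)) h <= \sum_i lam i * h ord0 i.
Proof.
move=> sub lam l0; elim/big_rec2: _ => [|i a x _ IH]; first by rewrite coord0 dotp0l.
apply: (le_trans (sub _ _)); rewrite lerD// coordZ// dotpZl ler_wpM2l//.
rewrite /dotp (bigD1 i)//= coord_generator eqxx mul1r big1 ?addr0// => j /negPf ji.
by rewrite coord_generator ji mul0r.
Qed.

(* Farkas' lemma turns sublinearity of [h] into a vertex [x_S] for every cone [S];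
   the polytope is the convex hull of these vertices. *)
Lemma defcone_realize h : (forall u w,
    dotp (coord (u + w)) h <= dotp (coord u) h + dotp (coord w) h) ->
  exists2 Q, in_defcone v Delta Q & forall i, hsupp Q (v i) = h ord0 i.
Proof.
move=> sub; have [_ _ r _] := fanP.
have vertex S : exists x, S \in Delta -> (forall i, dotp x (v i) <= h ord0 i) /\
    forall i, i \in S -> dotp x (v i) = h ord0 i.
  have [SD|] := boolP (S \in Delta); last by exists 0.
  have [[x [xle xS]]|[l [m [l0 m0 mS E lt]]]] := farkas_equality v (h ord0) S.
    by exists x.
  (* Both combinations of the alternative give the same vector. As [m] is supported on [S], it is
     the coordinate vector, and the strict inequality contradicts sublinearity. *)
  have := coord_sublinear_sum sub l0.
  rewrite E (coord_gcone SD m0 mS erefl); rewrite leNgt.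
  suff -> : dotp (\row_i m i) h = \sum_i m i * h ord0 i by rewrite lt.
  by apply: eq_bigr => i _; rewrite mxE.
have [X XP] := choice vertex.
(* A polytope must have points indexed by some ['I_k.+1]; [Delta] is nonempty since it contains the
   support of [[0]]. *)
have D0 : (0 < #|Delta|)%N by apply/card_gt0P; have [_ cD _] := coordP 0; eexists; exact: cD.
pose p (j : 'I_(#|Delta|.-1.+1)) := X (nth finset.set0 (enum Delta) j).
have pD (j : 'I_(#|Delta|.-1.+1)) : nth finset.set0 (enum Delta) j \in Delta.
  by rewrite -mem_enum mem_nth// -cardE -[ltnRHS](prednK D0).
have Xp S : S \in Delta -> Defs.conv p (X S).
  move=> SD; have lt : (index S (enum Delta) < #|Delta|.-1.+1)%N.
    by rewrite prednK// cardE index_mem mem_enum.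
  have -> : X S = p (Ordinal lt) by rewrite /p/= nth_index// mem_enum.
  exact: conv_vertex.
have Qp : is_polytope (Defs.conv p) by exists #|Delta|.-1, p.
have ub i x : Defs.conv p x -> dotp x (v i) <= h ord0 i.
  by apply: conv_dotp_le => j; exact: (XP _ (pD j)).1.
have hE i : hsupp (Defs.conv p) (v i) = h ord0 i.
  have Xi := (XP _ (r i)).2 i (finset.set11 i); rewrite -Xi.
  by apply: hsupp_max => [||y /(ub i)]//; [exact: Xp (r i)|rewrite Xi].
exists (Defs.conv p) => //; split=> // S SD.
have [_ XS] := XP _ SD.
(* A maximizer of the sum of the generators of [S] maximizes each of them, because [X S] attains all
   the upper bounds [h i] simultaneously. *)
pose w := \sum_(i in S) v i.
exists (normal_cone (Defs.conv p) (face (Defs.conv p) w)); split; first by exists w.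
move=> u [l [l0 [lS Eu]]] x [Qx xm].
have xS i : i \in S -> dotp x (v i) = h ord0 i.
  move=> iS; apply/eqP; rewrite eq_le ub//= -subr_le0.
  have : \sum_(i in S) (h ord0 i - dotp x (v i)) <= 0.
    have := xm _ (Xp _ SD); rewrite -subr_le0 /w !dotp_sumr => H.
    apply: le_trans H; rewrite -sumrB; apply: ler_sum => k kS.
    by rewrite XS.
  rewrite (bigD1 i)//=; apply: le_trans; rewrite lerDl sumr_ge0// => k _.
  by rewrite subr_ge0 ub.
split=> // y Qy; rewrite Eu !dotp_sumr; apply: ler_sum => i _; rewrite !dotpZr.
have [/xS ->|/lS ->] := boolP (i \in S); last by rewrite !mul0r.
by rewrite ler_wpM2l// ub.
Qed.

Lemma defcone_sublinear Q u w : in_defcone v Delta Q ->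
  let h := \row_i hsupp Q (v i) in
  dotp (coord (u + w)) h <= dotp (coord u) h + dotp (coord w) h.
Proof. by move=> QD /=; rewrite -!defcone_hsupp//; exact: hsuppD_le QD.1. Qed.

End Fan.

(** * Size of the coordinates *)

Section CoordBounds.
Context {R : realType} {d n : nat} (v : 'I_n -> 'rV[R]_d) (Delta : {set {set 'I_n}}).
Context (fanP : simplicial_polytopal_fan v Delta).
Local Notation coord := (Defs.coord v Delta).
Local Notation c := (cDelta v Delta).
Implicit Types (u x : 'rV[R]_d) (S : {set 'I_n}).

Lemma card_cone_le S : S \in Delta -> (#|S| <= d)%N.
Proof.
move=> SD; have [_ ind _ _] := fanP.
pose V := \matrix_(j < #|S|) v (enum_val j).
suff : row_free V by move=> /eqP <-; exact: rank_leq_col.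
apply: inj_row_free => w wV0.
pose lam i := \sum_(j < #|S| | enum_val j == i) w 0 j.
have lam0 : forall i, lam i = 0.
  apply: (ind _ SD) => [i iS|].
    by rewrite /lam big1// => j /eqP ji; rewrite -ji enum_valP in iS.
  rewrite -[RHS]wV0 mulmx_sum_row.
  rewrite [RHS](partition_big (fun j => enum_val j) xpredT)//=.
  apply: eq_bigr => i _; rewrite scaler_suml; apply: eq_bigr => j /eqP <-.
  by rewrite rowK.
apply/rowP => j; have := lam0 (enum_val j); rewrite mxE => <-.
rewrite /lam (bigD1 j)//= big1 ?addr0// => k /andP[/eqP/enum_val_inj ->].
by rewrite eqxx.
Qed.

(** Such a form bounds the sum of the coordinates of a point of the cone by its value there. The
    Farkas alternative would be a nontrivial linear relation between the generators. *)
Lemma cone_form S : S \in Delta -> exists x, forall i, i \in S -> 1 <= dotp x (v i).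
Proof.
move=> SD; have [_ ind _ _] := fanP.
have [[x xab]|[l [l0 [la lb]]]] := farkas_affine
    (fun i => if i \in S then - v i else 0) (fun i => if i \in S then -1 else 0 : R).
  by exists x => i iS; have := xab i; rewrite iS dotpNr lerN2.
have l00 i : (if i \in S then l i else 0) = 0.
  move: i; apply: (ind _ SD) => [i /negPf ->//|].
  apply/eqP; rewrite -oppr_eq0 -sumrN -[X in _ == X]la; apply/eqP.
  by apply: eq_bigr => i _; case: ifP; rewrite ?scalerN// scaler0 scale0r oppr0.
move: lb; rewrite big1 ?ltxx// => i _; have := l00 i.
by case: ifP => [_ ->|]; rewrite ?mul0r ?mulr0.
Qed.

(** [sup] takes a default value on unbounded sets, so this is what makes [cDelta] dominate the
    coordinates. There is one form per cone, and there are finitely many cones. *)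
Lemma coord_bounded : exists M, forall u i, enorm u = 1 -> coord u ord0 i <= M.
Proof.
have form S : exists x, S \in Delta -> forall i, i \in S -> 1 <= dotp x (v i).
  by have [/cone_form[x xS]|] := boolP (S \in Delta); [exists x|exists 0].
have [X XP] := choice form.
exists (\sum_S enorm (X S)) => u i u1; have [c0 cD cu] := coordP fanP u.
set S := [set _ | _]%SET in cD.
have le1 : coord u ord0 i <= \sum_i coord u ord0 i.
  by rewrite (bigD1 i)//= lerDl sumr_ge0.
apply: (le_trans le1).
apply: (@le_trans _ _ (enorm (X S))); last first.
  by rewrite (bigD1 S)//= lerDl sumr_ge0// => T _; exact: enorm_ge0.
rewrite -[leRHS]mulr1 -u1; apply: le_trans (CauchySchwarz _ _).
rewrite {2}cu dotp_sumr; apply: ler_sum => j _; rewrite dotpZr.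
have [->|cj] := eqVneq (coord u ord0 j) 0; first by rewrite mul0r.
by rewrite ler_peMr// (XP _ cD)// finset.inE.
Qed.

Lemma coord_le_cDelta u i : enorm u = 1 -> coord u ord0 i <= c.
Proof.
move=> u1; have [M MP] := coord_bounded.
apply: ub_le_sup; last by exists u, i.
by exists M => _ [w [j [w1 ->]]]; exact: MP.
Qed.

Lemma cDelta_ge i : (enorm (v i))^-1 <= c.
Proof.
have vi := enorm_gt0 (fan_generator_neq0 fanP i).
have : enorm ((enorm (v i))^-1 *: v i) = 1.
  by rewrite enormZ ger0_norm ?invr_ge0 ?ltW// mulVf// gt_eqF.
move=> /(coord_le_cDelta i); rewrite coordZ ?invr_ge0 ?(ltW vi)//.
by rewrite mxE coord_generator// eqxx mulr1.
Qed.

(** At most [d] coordinates are nonzero, each at most [c] on the unit sphere; homogeneity extends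
    the bound to all [u]. *)
Lemma enorm_coord_le u : enorm (coord u) <= Num.sqrt d%:R * c * enorm u.
Proof.
have [->|u0] := eqVneq u 0.
  by rewrite coord0// {1}/enorm dotp0l sqrtr0 {1}/enorm dotp0l sqrtr0 mulr0.
have eu := enorm_gt0 u0; pose w := (enorm u)^-1 *: u.
have w1 : enorm w = 1.
  by rewrite enormZ ger0_norm ?invr_ge0 ?ltW// mulVf// gt_eqF.
have uw : u = enorm u *: w by rewrite scalerA divff ?scale1r// gt_eqF.
clearbody w; rewrite uw.
rewrite coordZ ?(ltW eu)// !enormZ w1 mulr1 mulrC ler_wpM2r ?normr_ge0//.
have [c0 cD cw] := coordP fanP w.
have [i _] : exists i : 'I_n, true.
  apply: contrapT => /forallNP no; move: w1; rewrite cw big1.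
    by rewrite /enorm dotp0l sqrtr0 => /esym/eqP; rewrite oner_eq0.
  by move=> i; have := no i.
have c00 : 0 <= c by apply: le_trans (coord_le_cDelta i w1).
rewrite -[c]ger0_norm// -sqrtr_sqr -sqrtrM ?ler0n//; apply: ler_wsqrtr.
apply: (@le_trans _ _ (\sum_(i in [set i | coord w ord0 i != 0]%SET) c ^+ 2)).
  rewrite [leRHS]big_mkcond/=; apply: ler_sum => j _; rewrite finset.inE.
  have [->|cj] := eqVneq (coord w ord0 j) 0; first by rewrite mul0r.
  by rewrite -expr2 ler_sqr ?nnegrE// coord_le_cDelta.
rewrite sumr_const -[leLHS]mulr_natl ler_wpM2r ?sqr_ge0// ler_nat.
exact: card_cone_le.
Qed.

(** With a single generator, [u] and [- u] would both be nonnegative multiples of it with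
    coefficients summing to zero, although that of [u] is positive. *)
Lemma fan_two_rays u : u != 0 -> (1 < n)%N.
Proof.
move=> u0; have [a0 _ au] := coordP fanP u; have [b0 _ bu] := coordP fanP (- u).
have [i ai] : exists i, 0 < coord u ord0 i.
  apply: contrapT => /forallNP no; move/eqP: u0; apply; rewrite au big1// => i _.
  suff -> : coord u ord0 i = 0 by rewrite scale0r.
  by apply/eqP; have /negP := no i; rewrite lt_neqAle a0 andbT negbK eq_sym.
suff [j ji] : exists j : 'I_n, j != i.
  rewrite ltnNge; apply: contra ji => n1; apply/eqP/val_inj => /=.
  have : (j < 1)%N by exact: leq_trans (ltn_ord j) n1.
  have : (i < 1)%N by exact: leq_trans (ltn_ord i) n1.
  by rewrite !ltnS !leqn0 => /eqP -> /eqP ->.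
apply: contrapT => /forallNP no.
have one (l : 'I_n -> R) : \sum_j l j *: v j = l i *: v i.
  by rewrite (bigD1 i)//= big1 ?addr0// => j ji; have := no j; rewrite ji.
have : (coord u ord0 i + coord (- u) ord0 i) *: v i = 0.
  by rewrite scalerDl -!one -au -bu subrr.
move=> /eqP; rewrite scaler_eq0 (negPf (fan_generator_neq0 fanP i)) orbF.
by rewrite gt_eqF// ltr_wpDr.
Qed.

End CoordBounds.

(** * Least squares and Hausdorff distance *)

Section LeastSquares.
Context {R : realType} {n : nat}.
Implicit Types (x z : 'rV[R]_n).

(** The family may be infinite: it describes both the support vectors of the deformation cone and,
    for metric projection, a single polytope. *)
Definition halfspaces (F : set ('rV[R]_n * R)) : set 'rV[R]_n :=
  [set x | forall a, F a -> dotp a.1 x <= a.2].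

Definition residual (m : nat) (A : 'I_m -> 'rV[R]_n) (y : 'I_m -> R) x :=
  \sum_(k < m) (dotp (A k) x - y k) ^+ 2.

Lemma continuous_coordinate (i : 'I_n) : continuous (fun x : 'rV[R]_n => x ord0 i).
Proof. exact: coord_continuous. Qed.

Lemma continuous_dotp (a : 'rV[R]_n) : continuous (dotp a).
Proof.
apply: continuous_big => [|i _ x]; first exact: add_continuous.
have H : a ord0 i @[z --> x] --> a ord0 i by exact: (@cvg_cst _ _ _ _ (nbhs_filter x)).
exact: (cvgM H (@continuous_coordinate i x)).
Qed.

Lemma continuous_residual (m : nat) (A : 'I_m -> 'rV[R]_n) y : continuous (residual A y).
Proof.
apply: continuous_big => [|k _ x]; first exact: add_continuous.
have H : dotp (A k) z - y k @[z --> x] --> dotp (A k) x - y k.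
  exact: (cvgB (@continuous_dotp (A k) x) (@cvg_cst _ (y k) _ _ (nbhs_filter x))).
exact: (cvgM H H).
Qed.

Lemma closed_halfspaces F : closed (halfspaces F).
Proof.
rewrite (_ : halfspaces F = \bigcap_(a in F) (dotp a.1 @^-1` [set r | r <= a.2])).
  apply: closed_bigI => a _; apply: closed_comp; last exact: closed_le.
  by move=> x _; exact: continuous_dotp.
by apply/seteqP; split=> x Hx a Fa; exact: Hx.
Qed.

Lemma residual_min (m : nat) (A : 'I_m -> 'rV[R]_n) y F (alpha : R) : 0 < alpha ->
  (forall x, alpha * dotp x x <= \sum_(k < m) dotp (A k) x ^+ 2) ->
  halfspaces F !=set0 ->
  exists2 x, halfspaces F x & forall z, halfspaces F z -> residual A y x <= residual A y z.
Proof.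
move=> a0 coercive [x0 Fx0].
pose K := halfspaces F `&` [set x | residual A y x <= residual A y x0].
have clK : closed K.
  apply: closedI; first exact: closed_halfspaces.
  apply: (@closed_comp _ _ (residual A y) [set r | r <= residual A y x0]).
    by move=> x _; exact: continuous_residual.
  exact: closed_le.
(* By [a^2 <= 2 (a - y)^2 + 2 y^2], coercivity bounds every squared coordinate on the sublevel set
   of [x0] by [B]. *)
pose B := (2 * residual A y x0 + 2 * \sum_k y k ^+ 2) / alpha.
have sqB x i : K x -> x ord0 i ^+ 2 <= B.
  move=> [_ /= rx]; rewrite /B ler_pdivlMr// mulrC.
  apply: (@le_trans _ _ (alpha * dotp x x)).
    rewrite ler_wpM2l ?(ltW a0)// /dotp (bigD1 i)//= -expr2 lerDl sumr_ge0// => j _.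
    by rewrite -expr2 sqr_ge0.
  apply: (le_trans (coercive x)).
  apply: (@le_trans _ _ (2 * residual A y x + 2 * \sum_k y k ^+ 2)).
    rewrite /residual -mulrDr -big_split/= mulr_sumr; apply: ler_sum => k _.
    by have := sqr_ge0 (dotp (A k) x - 2 * y k); rewrite -subr_ge0 => H; nra.
  by rewrite lerD2r ler_pM2l.
have cK : compact K.
  apply: bounded_closed_compact clK; exists (1 + B); split; first exact: num_real.
  move=> M BM x Kx; rewrite /= [leLHS]/Num.norm/= mx_normrE.
  apply: bigmax_le => [|[i j] _ /=].
    have : 0 <= B.
      by rewrite divr_ge0 ?(ltW a0)// addr_ge0// mulr_ge0// sumr_ge0// => k _; exact: sqr_ge0.
    lra.
  have := sqB x j Kx; rewrite (_ : i = ord0) ?ord1//= -real_normK ?num_real//.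
  have := normr_ge0 (x ord0 j); nra.
have K0 : K !=set0 by exists x0; split => //=.
have [x /set_mem [Fx /= rx] xm] := compact_EVT_min K0 cK
  (continuous_subspaceT (@continuous_residual m A y)).
exists x => // z Fz; have [zx|/ltW zx] := leP (residual A y z) (residual A y x0).
  by apply: xm; apply/mem_set.
exact: le_trans rx zx.
Qed.

(* Differentiate along the segment from [x] to [z]. *)
Lemma residual_variational (m : nat) (A : 'I_m -> 'rV[R]_n) y F x z :
  halfspaces F x -> (forall z, halfspaces F z -> residual A y x <= residual A y z) ->
  halfspaces F z ->
  \sum_(k < m) dotp (A k) (z - x) ^+ 2 <= residual A y z - residual A y x.
Proof.
move=> Fx xm Fz; pose S := \sum_(k < m) dotp (A k) (z - x) ^+ 2.
pose G := \sum_(k < m) (dotp (A k) x - y k) * dotp (A k) (z - x).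
have expand s : residual A y (x + s *: (z - x)) - residual A y x = 2 * s * G + s ^+ 2 * S.
  rewrite /residual /G /S !mulr_sumr -sumrB -big_split/=; apply: eq_bigr => k _.
  by rewrite dotpDr dotpZr; ring.
have S0 : 0 <= S by apply: sumr_ge0 => k _; exact: sqr_ge0.
have G0 : 0 <= G.
  rewrite leNgt; apply/negP => G0.
  have key s : 0 < s <= 1 -> 0 <= 2 * G + s * S.
    move=> /andP[s0 s1]; rewrite -(pmulr_rge0 _ s0) mulrDr mulrCA mulrA [s * (s * S)]mulrA -expr2.
    rewrite -expand subr_ge0; apply: xm => a Fa.
    have := Fx _ Fa; have := Fz _ Fa; rewrite dotpDr dotpZr dotpBr => h1 h2; nra.
  pose s := - G / (1 - G + S).
  have D : 0 < 1 - G + S by lra.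
  have : 0 < s <= 1.
    by rewrite /s divr_gt0 ?oppr_gt0//= ler_pdivrMr// mul1r; lra.
  move=> /key; have : s * S <= - G.
    rewrite /s mulrAC ler_pdivrMr// ler_wpM2l//; lra.
  lra.
have := expand 1; rewrite scale1r (_ : x + (z - x) = z); last by rewrite addrC subrK.
by rewrite -/S => ->; lra.
Qed.

End LeastSquares.

(** * Hausdorff distance through support functions *)

Section Hausdorff.
Context {R : realType} {d : nat}.
Implicit Types (Q P : set 'rV[R]_d) (u x : 'rV[R]_d).

Lemma dotp_delta i x : dotp (delta_mx ord0 i : 'rV[R]_d) x = x ord0 i.
Proof.
rewrite /dotp (bigD1 i)//= mxE !eqxx mul1r big1 ?addr0// => j /negPf ji.
by rewrite mxE eqxx ji mul0r.
Qed.

(** Metric projection is least squares with the unit vectors as design and the coordinates of [x] as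
    data; the variational inequality, expanded, is the obtuse-angle inequality. *)
Lemma polytope_projection P x : is_polytope P ->
  exists2 p, P p & forall q, P q -> dotp q (x - p) <= dotp p (x - p).
Proof.
move=> Pp; pose F := [set a : 'rV[R]_d * R | hsupp P a.1 <= a.2].
have PF q : P q <-> halfspaces F q.
  split=> [Pq a Fa|Fq].
    by apply: le_trans Fa; rewrite dotpC; exact: hsupp_ge.
  by apply: polytope_support => // u; rewrite dotpC; exact: (Fq (u, hsupp P u) (lexx _)).
have [p0 [Pp0 _ _]] := polytope_hsupp 0 Pp.
have E (z : 'rV[R]_d) : \sum_(k < d) dotp (delta_mx ord0 k) z ^+ 2 = dotp z z.
  by apply: eq_bigr => k _; rewrite dotp_delta expr2.
have [||p Fp pm] := @residual_min R d d (fun i => delta_mx ord0 i) (fun i => x ord0 i) F 1 ltr01.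
- by move=> z; rewrite E mul1r.
- by exists p0; apply/PF.
have resE (z : 'rV[R]_d) : residual (fun i : 'I_d => delta_mx ord0 i) (fun i => x ord0 i) z = dotp (z - x) (z - x).
  by apply: eq_bigr => k _; rewrite dotp_delta expr2 !mxE.
exists p => [|q /PF Fq]; first exact/PF.
have := residual_variational Fp pm Fq; rewrite E !resE => H.
rewrite -subr_ge0; have {H} := H; rewrite !(dotpBl, dotpBr).
rewrite (dotpC p x) (dotpC q x) (dotpC p q); lra.
Qed.

(** For the projection [p] of [x] on [P], the support value of [P] in direction [x - p] is attained
    at [p], so [|x - p|^2] is at most the difference of the support values there. *)
Lemma setdist_le Q P (r : R) x : is_polytope P -> is_polytope Q -> 0 <= r ->
  (forall u, hsupp Q u - hsupp P u <= r * enorm u) -> Q x -> setdist x P <= r.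
Proof.
move=> Pp Qp r0 QP Qx; have [p Pp' pm] := polytope_projection x Pp.
apply: (@le_trans _ _ (enorm (x - p))).
  by apply: ge_inf; [exists 0 => _ [q _ <-]; exact: enorm_ge0|exists p].
have [->|xp] := eqVneq (x - p) 0; first by rewrite /enorm dotp0l sqrtr0.
have e0 := enorm_gt0 xp; rewrite -(ler_pM2r e0) -expr2 sqr_enorm.
apply: le_trans (QP _); rewrite (hsupp_max Pp Pp' pm) {1}dotpBl lerB//.
exact: hsupp_ge.
Qed.

Lemma dH_le Q P (r : R) : is_polytope Q -> is_polytope P -> 0 <= r ->
  (forall u, `|hsupp Q u - hsupp P u| <= r * enorm u) -> dH Q P <= r.
Proof.
move=> Qp Pp r0 QP; have [q [Qq _ _]] := polytope_hsupp 0 Qp.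
have [p [Pq _ _]] := polytope_hsupp 0 Pp.
rewrite /dH ge_max; apply/andP; split; apply: ge_sup.
- by exists (setdist q P), q.
- move=> _ [x Qx <-]; apply: (setdist_le Pp Qp r0 _ Qx) => u.
  exact: le_trans (ler_norm _) (QP u).
- by exists (setdist p Q), p.
- move=> _ [x Px <-]; apply: (setdist_le Qp Pp r0 _ Px) => u.
  by apply: le_trans (QP u); rewrite distrC ler_norm.
Qed.

End Hausdorff.

(** * Sums of independent Gaussians *)

Section Density.
Context d d' (T : measurableType d) (T' : measurableType d') (R : realType).
Context (mu : {measure set T -> \bar R}) (nu : {measure set T' -> \bar R}).
Context (X : T -> T') (g : T -> R).
Context (mX : measurable_fun setT X) (mg : measurable_fun setT g) (g0 : forall x, 0 <= g x).
Context (nuE : forall B, measurable B -> nu B = (\int[mu]_(x in X @^-1` B) (g x)%:E)%E).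
Local Open Scope ereal_scope.
Import HBNNSimple.

Lemma integral_density_nnsfun (h : {nnsfun T' >-> R}) :
  \int[nu]_y (h y)%:E = \int[mu]_x (h (X x) * g x)%:E.
Proof.
have mpre r : measurable (X @^-1` (h @^-1` [set r])).
  by rewrite -(setTI (_ @^-1` _)); apply: mX => //.
have mind r : measurable_fun setT (fun x => (r * \1_(h @^-1` [set r]) (X x) * g x)%:E).
  apply/measurable_EFinP; apply: measurable_funM => //; apply: measurable_funM => //.
  by apply: measurableT_comp mX; exact: measurable_indic.
rewrite integralT_nnsfun sintegralE.
under [RHS]eq_integral => x _.
  rewrite (fimfunE h (X x)) fsbig_finite//= big_distrl/= -sumEFin -fsbig_finite//=; over.
rewrite ge0_integral_fsum//; last first.
  move=> r x _; rewrite EFinM mule_ge0 ?lee_fin//.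
  exact: nnfun_muleindic_ge0.
apply: eq_fsbigr => r /[!inE] -[y _ <-].
rewrite nuE// [RHS](eq_integral (fun x => (h y)%:E * ((fun x => (g x)%:E) \_ (X @^-1` (h @^-1` [set h y]))) x)).
  rewrite ge0_integralZl//.
  - by rewrite -integral_mkcond.
  - by apply/measurable_restrict => //; rewrite setTI; apply/measurable_EFinP; apply: measurable_funTS.
  - by move=> x _; rewrite erestrict_ge0// => z _; rewrite lee_fin.
  - by rewrite lee_fin.
move=> x _; rewrite /patch indicE; case: ifPn => [|] xin.
  rewrite (_ : X x \in _); first by rewrite mulr1 EFinM.
  by rewrite inE; rewrite inE in xin.
rewrite (_ : (X x \in _) = false); first by rewrite mulr0 mul0r mule0.
by apply/negbTE; apply: contra xin; rewrite !inE.
Qed.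

(** Used with the product of the remaining factors as [g] for independence, and with [X] the
    identity and [g] the Gaussian density for the moment generating function. *)
Lemma integral_density (f : T' -> \bar R) : measurable_fun setT f -> (forall y, 0 <= f y) ->
  \int[nu]_y f y = \int[mu]_x (f (X x) * (g x)%:E).
Proof.
move=> mf f0; pose h := nnsfun_approx measurableT mf.
have hf y : (h n y)%:E @[n --> \oo] --> f y by exact: cvg_nnsfun_approx.
have -> : \int[nu]_y f y = limn (fun n => \int[nu]_y (h n y)%:E).
  under eq_integral => y _ do rewrite -(cvg_lim _ (hf y))//.
  apply: monotone_convergence => //.
  - by move=> n; apply/measurable_EFinP; exact/measurable_funP.
  - by move=> n y _; rewrite lee_fin.
  - by move=> y _ a b ab; rewrite lee_fin; exact/lefP/nd_nnsfun_approx.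
have -> : \int[mu]_x (f (X x) * (g x)%:E) = limn (fun n => \int[mu]_x (h n (X x) * g x)%:E).
  have gf x : (h n (X x) * g x)%:E @[n --> \oo] --> f (X x) * (g x)%:E.
    by under eq_fun do rewrite EFinM; apply: cvgeZr.
  under eq_integral => x _ do rewrite -(cvg_lim _ (gf x))//.
  apply: monotone_convergence => //.
  - move=> n; apply/measurable_EFinP; apply: measurable_funM => //.
    by apply: measurableT_comp mX; exact/measurable_funP.
  - by move=> n y _; rewrite lee_fin mulr_ge0.
  - by move=> x _ a b ab; rewrite lee_fin ler_wpM2r//; exact/lefP/nd_nnsfun_approx.
by under eq_fun do rewrite integral_density_nnsfun.
Qed.

End Density.

(** * Expectation of a product of independent factors *)

Section Independence.
Context (R : realType) (dd : measure_display) (Omega : measurableType dd)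
  (Pr : probability Omega R) (X : nat -> {RV Pr >-> R}).
Context (indX : mutually_independent X).

(** Factors are freed from being indicators one at a time; for empty [s1] the claim is the
    definition of independence. To free [j], the induction hypothesis identifies the expectation of
    [1_B(X j)] times the other factors with a multiple of the law of [X j], as a measure in [B], and
    [phi j] is integrated against it. *)
Lemma expectation_prod_partial (s s1 : seq nat) (phi : nat -> R -> R) (c : nat -> R) :
  uniq s -> (forall i, measurable_fun setT (phi i)) -> (forall i x, 0 <= phi i x) ->
  (forall i, i \in s -> i \notin s1 -> exists2 B, measurable B & phi i = \1_B) ->
  (forall i, (\int[Pr]_w (phi i (X i w))%:E = (c i)%:E)%E) ->
  (\int[Pr]_w (\prod_(i <- s) phi i (X i w))%:E = (\prod_(i <- s) c i)%:E)%E.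
Proof.
move=> us; elim: s1 phi c => [|j s1 IH] phi c mphi phi0 ind Ec.
  have ex i : exists B : set R, measurable B /\ (i \in s -> phi i = \1_B).
    have [/ind|] := boolP (i \in s); last by exists set0.
    by move=> /(_ isT)[B mB ->]; exists B.
  have [B BP] := choice ex.
  have mX i : measurable (X i @^-1` B i).
    by rewrite -(setTI (_ @^-1` _)); apply: measurable_funP => //; exact: (BP i).1.
  have cE i : i \in s -> Pr (X i @^-1` B i) = (c i)%:E.
    move=> si; have [mB /(_ si) pB] := BP i; rewrite -Ec pB.
    rewrite (eq_integral (fun w => (\1_(X i @^-1` B i) w)%:E))//.
    by rewrite integral_indic// setIT.
  rewrite (eq_integral (fun w => (\1_(\big[setI/setT]_(i <- s) (X i @^-1` B i)) w)%:E)).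
    rewrite integral_indic//; last by apply: bigsetI_measurable => i _.
    rewrite setIT.
    apply: (eq_trans (@indX s B us (fun i => (BP i).1))).
    rewrite big_seq (eq_bigr (fun i => (c i)%:E)); last by move=> i; exact: cE.
    rewrite -big_seq; elim: (s) => [|i r IHr]; first by rewrite !big_nil.
    by rewrite !big_cons IHr EFinM.
  move=> w _; congr EFin; rewrite big_seq (eq_bigr (fun i => \1_(X i @^-1` B i) w)).
    rewrite -big_seq; elim: (s) => [|i r IHr]; first by rewrite !big_nil indicE in_setT.
    by rewrite !big_cons IHr indicI.
  by move=> i /(BP i).2 ->.
have [js|js] := boolP (j \in s); last first.
  apply: IH => // i si i1; apply: ind => //; rewrite inE negb_or i1 andbT.
  by apply: contraNneq js => <-.
pose C := \prod_(i <- s | i != j) c i.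
have c0 i : 0 <= c i.
  by rewrite -lee_fin -Ec; apply: integral_ge0 => w _; rewrite lee_fin.
have C0 : 0 <= C by apply: prodr_ge0.
pose g w := \prod_(i <- s | i != j) phi i (X i w).
have mg : measurable_fun setT g.
  rewrite /g; under eq_fun do rewrite -big_filter.
  by apply: measurable_prod => i _; exact: measurableT_comp.
have g0 w : 0 <= g w by apply: prodr_ge0.
have nuE B : measurable B ->
    mscale (NngNum C0) (distribution Pr (X j)) B = (\int[Pr]_(w in X j @^-1` B) (g w)%:E)%E.
  move=> mB; have mXB : measurable (X j @^-1` B).
    by rewrite -(setTI (_ @^-1` _)); apply: measurable_funP.
  pose phi' i := if i == j then \1_B else phi i.
  pose c' i := if i == j then fine (Pr (X j @^-1` B)) else c i.
  have := IH phi' c'; rewrite (bigD1_seq j)//= /c' eqxx.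
  rewrite (eq_bigr c); last by move=> i /negPf ->.
  rewrite -/C => H; rewrite /mscale/= /distribution/= /pushforward.
  have {}H : (\int[Pr]_w (\prod_(i <- s) phi' i (X i w))%:E = (fine (Pr (X j @^-1` B)) * C)%:E)%E.
    apply: H.
    - by move=> i; rewrite /phi'; case: ifP => // _; exact: measurable_indic.
    - by move=> i x; rewrite /phi'; case: ifP.
    - move=> i si i1; rewrite /phi'; have [_|ij] := eqVneq i j; first by exists B.
      by apply: ind => //; rewrite inE negb_or ij.
    - move=> i; rewrite /phi'; have [->|ij //] := eqVneq i j.
      rewrite (eq_integral (fun w => (\1_(X j @^-1` B) w)%:E))//.
      by rewrite integral_indic// setIT fineK// fin_num_measure.
  transitivity (\int[Pr]_w (\prod_(i <- s) phi' i (X i w))%:E)%E.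
    by rewrite H mulrC EFinM fineK// fin_num_measure.
  rewrite [RHS]integral_mkcond; apply: eq_integral => w _.
  rewrite (bigD1_seq j)//= {1}/phi' eqxx.
  rewrite (eq_bigr (fun i => phi i (X i w))); last by move=> i /negPf ij; rewrite /phi' ij.
  rewrite /patch indicE -/(g w); have [wB|wB] := boolP (X j w \in B).
    by rewrite mul1r mem_set//=; rewrite inE in wB.
  by rewrite mul0r memNset//= => ?; move/negP: wB; apply; rewrite inE.
have mphiE : measurable_fun setT (fun x => (phi j x)%:E) by exact/measurable_EFinP.
have phiE0 x : (0 <= (phi j x)%:E)%E by rewrite lee_fin.
have := integral_density (measurable_funP (X j)) mg g0 nuE mphiE phiE0.
rewrite ge0_integral_mscale//= (@ge0_integral_distribution _ _ _ _ _ Pr (X j))//.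
rewrite Ec -EFinM => E.
rewrite (bigD1_seq j)//= mulrC E; apply: eq_integral => w _.
by rewrite -EFinM (bigD1_seq j).
Qed.

Lemma expectation_prod (m : nat) (phi : nat -> R -> R) (c : nat -> R) :
  (forall i, measurable_fun setT (phi i)) -> (forall i x, 0 <= phi i x) ->
  (forall i, (\int[Pr]_w (phi i (X i w))%:E = (c i)%:E)%E) ->
  (\int[Pr]_w (\prod_(i < m) phi i (X i w))%:E = (\prod_(i < m) c i)%:E)%E.
Proof.
move=> mphi phi0 Ec; rewrite -(big_mkord xpredT c).
under eq_integral do rewrite -(big_mkord xpredT (fun i => phi i (X i _))).
apply: (@expectation_prod_partial _ (index_iota 0 m)) => //; first exact: iota_uniq.
by move=> i ->.
Qed.

End Independence.

(** * Gaussian tails of weighted sums *)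

Section SubGaussian.
Context (R : realType) (dd : measure_display) (Omega : measurableType dd)
  (Pr : probability Omega R).

(* Completing the square: [expR (b x)] times the centered density of deviation
   [s] is [expR (b^2 s^2 / 2)] times the density centered at [b s^2]. *)
Lemma normal_mgf (X : {RV Pr >-> R}) (s b : R) : 0 < s ->
  (forall B, measurable B -> distribution Pr X B = normal_prob 0 s B) ->
  (\int[Pr]_w (expR (b * X w))%:E = (expR (b ^+ 2 * s ^+ 2 / 2))%:E)%E.
Proof.
move=> s0 XE; have s_neq0 : s != 0 by rewrite gt_eqF.
have me : measurable_fun setT (fun x : R => (expR (b * x))%:E).
  by apply/measurable_EFinP; apply: measurableT_comp => //; exact: measurable_funM.
have e0 x : (0 <= (expR (b * x))%:E)%E by rewrite lee_fin expR_ge0.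
have <- := @ge0_integral_distribution _ _ _ _ _ Pr X _ me e0.
rewrite (@integral_density _ _ _ _ R lebesgue_measure (distribution Pr X) id (normal_pdf 0 s))//.
- transitivity (\int[lebesgue_measure]_x ((expR (b ^+ 2 * s ^+ 2 / 2))%:E * (normal_pdf (b * s ^+ 2) s x)%:E))%E.
    apply: eq_integral => x _; rewrite -!EFinM; congr EFin.
    rewrite !normal_pdfE// /normal_fun mulrCA [RHS]mulrCA; congr (_ * _).
    by rewrite -!expRD; congr expR; field.
  rewrite ge0_integralZl//.
  + by rewrite integral_normal_pdf mule1.
  + by apply/measurable_EFinP; exact: measurable_normal_pdf.
  + by move=> x _; rewrite lee_fin normal_pdf_ge0.
- exact: measurable_normal_pdf.
- by move=> x; exact: normal_pdf_ge0.
Qed.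

Context (eps : nat -> {RV Pr >-> R}) (sigma : nat -> R).
Context (sigma0 : forall k, 0 < sigma k).
Context (epsE : forall k (B : set R), measurable B ->
     distribution Pr (eps k) B = normal_prob 0 (sigma k) B).
Context (ind : mutually_independent eps).

Definition weighted_noise (m : nat) (a : nat -> R) (w : Omega) := \sum_(k < m) a k * eps k w.

Lemma measurable_weighted_noise m a : measurable_fun setT (weighted_noise m a).
Proof. by apply: measurable_sum => k; exact: measurable_funM. Qed.

HB.instance Definition _ m a := isMeasurableFun.Build _ _ _ _ (weighted_noise m a)
  (measurable_weighted_noise m a).

Lemma weighted_noise_mgf m a r :
  ('M_Pr (weighted_noise m a) r =
   (expR (r ^+ 2 * (\sum_(k < m) a k ^+ 2 * sigma k ^+ 2) / 2))%:E)%E.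
Proof.
rewrite /mmt_gen_fun unlock.
rewrite (eq_integral (fun w => (\prod_(k < m) expR ((r * a k) * eps k w))%:E)); last first.
  move=> w _ /=; rewrite -expR_sum; congr (expR _)%:E.
  by rewrite /weighted_noise mulr_suml; apply: eq_bigr => k _; ring.
rewrite (@expectation_prod _ _ _ _ _ ind m (fun k x => expR ((r * a k) * x))
  (fun k => expR ((r * a k) ^+ 2 * sigma k ^+ 2 / 2))).
- rewrite -expR_sum; congr (expR _)%:E; rewrite mulr_sumr mulr_suml.
  by apply: eq_bigr => k _; rewrite exprMn !mulrA.
- by move=> k; apply: measurableT_comp => //; exact: measurable_funM.
- by move=> k x; exact: expR_ge0.
- by move=> k; apply: normal_mgf => //; exact: epsE.
Qed.

Lemma weighted_noise_tail m (a : nat -> R) (V s : R) : 0 < V -> 0 < s ->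
  \sum_(k < m) a k ^+ 2 * sigma k ^+ 2 <= V ->
  (Pr [set w | (s <= weighted_noise m a w)%R] <= (expR (- (s ^+ 2 / (2 * V))))%:E)%E.
Proof.
(* [s / V] minimizes the Chernoff exponent [r^2 V / 2 - r s]. *)
move=> V0 s0 aV; have r0 : 0 < s / V by rewrite divr_gt0.
apply: (le_trans (chernoff (weighted_noise m a) s r0)).
rewrite weighted_noise_mgf -EFinM lee_fin -expRD ler_expR.
apply: (@le_trans _ _ ((s / V) ^+ 2 * V / 2 - s / V * s)).
  by rewrite lerD2r ler_wpM2r// ler_wpM2l// sqr_ge0.
by rewrite le_eqVlt; apply/orP; left; apply/eqP; field; rewrite gt_eqF.
Qed.

Lemma weighted_noise_abs_tail m (a : nat -> R) (V s : R) : 0 < V -> 0 < s ->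
  \sum_(k < m) a k ^+ 2 * sigma k ^+ 2 <= V ->
  (Pr [set w | (s <= `|weighted_noise m a w|)%R] <= (2 * expR (- (s ^+ 2 / (2 * V))))%:E)%E.
Proof.
move=> V0 s0 aV; have aV' : \sum_(k < m) (- a k) ^+ 2 * sigma k ^+ 2 <= V.
  by under eq_bigr do rewrite sqrrN.
have mS b : measurable [set w | s <= weighted_noise m b w].
  rewrite (_ : [set _ | _] = weighted_noise m b @^-1` [set` `[s, +oo[]).
    by rewrite -[X in measurable X]setTI; apply: measurable_weighted_noise.
  by apply/seteqP; split=> w /=; rewrite in_itv/= andbT.
have -> : [set w | s <= `|weighted_noise m a w|] =
    [set w | s <= weighted_noise m a w] `|` [set w | s <= weighted_noise m (fun k => - a k) w].
  have E w : weighted_noise m (fun k => - a k) w = - weighted_noise m a w.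
    by rewrite /weighted_noise -sumrN; apply: eq_bigr => k _; rewrite mulNr.
  apply/seteqP; split=> w /=; rewrite E ler_normr.
    by move=> /orP[]; [left|right].
  by case=> ->; rewrite ?orbT.
apply: (le_trans (measureU2 _ (mS a) (mS _))).
rewrite mulr_natl mulr2n EFinD; apply: leeD; exact: weighted_noise_tail.
Qed.

End SubGaussian.

(** * The least-squares estimator *)

Section Design.
Context {R : realType} {d n : nat} (v : 'I_n -> 'rV[R]_d) (Delta : {set {set 'I_n}}).
Context (fanP : simplicial_polytopal_fan v Delta).
Context (u : nat -> 'rV[R]_d) (t delta : R) (N : nat).
Context (u1 : forall k, enorm (u k) = 1).
Context (t0 : 0 <= t) (t_half : t < 1 / 2) (delta0 : 0 < delta) (N0 : (0 < N)%N).
Local Notation p := (5 / 2 * n%:R * t + delta).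
Context (countP : forall (m : nat) (i : 'I_n), (N <= m)%N ->
  m%:R * p <= (#|[set k : 'I_m | `[< Ct v Delta t i (u k) >]]|)%:R).
Local Notation coord := (Defs.coord v Delta).
Local Notation c := (cDelta v Delta).
Local Notation vmax := (sup [set enorm (v i) ^+ 2 | i in [set: 'I_n]]).
Local Notation vmin := (inf [set enorm (v i) ^+ 2 | i in [set: 'I_n]]).
Local Notation lambda := (c ^+ 2 - (c ^+ 2 - t ^+ 2 / vmin) * (n%:R - 1) * p).
Implicit Types (m : nat) (i j : 'I_n) (x h : 'rV[R]_n).

Lemma design_neq0 k : u k != 0.
Proof.
apply: contra_eq_neq (u1 k) => ->.
by rewrite /enorm dotp0l sqrtr0 eq_sym oner_neq0.
Qed.

Lemma n_ge2 : (2 : R) <= n%:R.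
Proof. by rewrite ler_nat; exact: (fan_two_rays fanP (design_neq0 0%N)). Qed.

Lemma enorm_v_gt0 i : 0 < enorm (v i).
Proof. exact: (enorm_gt0 (fan_generator_neq0 fanP i)). Qed.

Lemma some_index : exists i : 'I_n, true.
Proof. by have := fan_two_rays fanP (design_neq0 0%N); case: (n) => // k _; exists ord0. Qed.

Lemma cDelta_gt0 : 0 < c.
Proof.
have [i _] := some_index; apply: lt_le_trans (cDelta_ge fanP i).
by rewrite invr_gt0 enorm_v_gt0.
Qed.

Lemma vmax_ge i : enorm (v i) ^+ 2 <= vmax.
Proof.
apply: ub_le_sup; last by exists i.
exists (\sum_j enorm (v j) ^+ 2) => _ [j _ <-].
by rewrite (bigD1 j)//= lerDl sumr_ge0// => k _; exact: sqr_ge0.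
Qed.

Lemma vmax_gt0 : 0 < vmax.
Proof.
have [i _] := some_index; apply: lt_le_trans (vmax_ge i).
by rewrite exprn_gt0// enorm_v_gt0.
Qed.

Lemma vmin_le i : vmin <= enorm (v i) ^+ 2.
Proof. by apply: ge_inf; [exists 0 => _ [j _ <-]; exact: sqr_ge0|exists i]. Qed.

Lemma sqr_cDelta_ge i : 1 <= c ^+ 2 * enorm (v i) ^+ 2.
Proof.
rewrite -exprMn -[1](expr1n _ 2) ler_sqr ?nnegrE ?mulr_ge0 ?(ltW cDelta_gt0)// ?enorm_ge0//.
by rewrite -ler_pdivrMr ?enorm_v_gt0// mul1r cDelta_ge.
Qed.

Lemma vmin_ge : c ^- 2 <= vmin.
Proof.
have [i _] := some_index; apply: lb_le_inf; first by exists (enorm (v i) ^+ 2), i.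
move=> _ [j _ <-]; rewrite -[_ ^- 2]mul1r ler_pdivrMr ?exprn_gt0 ?cDelta_gt0// mulrC.
exact: sqr_cDelta_ge.
Qed.

Lemma vmin_gt0 : 0 < vmin.
Proof. by apply: lt_le_trans vmin_ge; rewrite invr_gt0 exprn_gt0 ?cDelta_gt0. Qed.

Definition near_ray m i : {set 'I_m} := [set k : 'I_m | `[< Ct v Delta t i (u k) >]]%SET.

Lemma near_rayP m i (k : 'I_m) : reflect (Ct v Delta t i (u k)) (k \in near_ray m i).
Proof. by rewrite finset.inE; exact: asboolP. Qed.

Lemma card_near_ray m i : (N <= m)%N -> m%:R * p <= #|near_ray m i|%:R.
Proof.
move=> Nm; apply: le_trans (countP i Nm) _; rewrite le_eqVlt; apply/orP; left.
apply/eqP; congr (_%:R); apply: eq_card => k.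
by rewrite finset.inE; apply/idP/idP => [/set_mem|H]; last exact: mem_set.
Qed.

(** Otherwise the scaled coordinate at [i] would be within [t < 1 / 2] of both 1 and 0. *)
Lemma near_ray_disjoint m i j (k : 'I_m) :
  k \in near_ray m i -> k \in near_ray m j -> i = j.
Proof.
move=> /near_rayP ki /near_rayP kj; apply/eqP/negPn/negP => ij.
have := ki i; have := kj i; rewrite eqxx (negPf ij) subr0 !ler_norml.
move=> /andP[_ h1] /andP[h2 _]; move: h2; rewrite /= mulr1n => h2; have : 1 / 2 <= t by lra.
by rewrite leNgt t_half.
Qed.

Lemma sum_near_ray m (f : 'I_m -> R) : (forall k, 0 <= f k) ->
  \sum_i \sum_(k in near_ray m i) f k <= \sum_k f k.
Proof.
move=> f0; under eq_bigr do rewrite big_mkcond; rewrite exchange_big/=.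
apply: ler_sum => k _.
have [[i ki]|no] := pselect (exists i, k \in near_ray m i).
  rewrite (bigD1 i)//= ki big1 ?addr0// => j ji.
  by case: ifP => // kj; rewrite (near_ray_disjoint kj ki) eqxx in ji.
by rewrite big1// => i _; case: ifP => // ki; case: no; exists i.
Qed.

Lemma p_gt0 : 0 < p.
Proof. by rewrite ltr_wpDl// !mulr_ge0// ?divr_ge0. Qed.

(** The [n] disjoint groups of at least [N p] directions fit among the first [N]. *)
Lemma p_le : n%:R * p <= 1.
Proof.
have N0' : 0 < N%:R :> R by rewrite ltr0n.
rewrite -(ler_pM2l N0') mulr1.
apply: (@le_trans _ _ (\sum_i \sum_(k in near_ray N i) (1 : R))).
  have -> : N%:R * (n%:R * p) = \sum_(i < n) N%:R * p.
    by rewrite sumr_const card_ord -[RHS]mulr_natl mulrCA.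
  by apply: ler_sum => i _; rewrite sumr_const; exact: card_near_ray.
apply: le_trans (sum_near_ray (f := fun=> 1) (fun=> ler01)) _.
by rewrite sumr_const card_ord.
Qed.

Lemma delta_le1 : delta <= 1.
Proof.
have nt : 0 <= n%:R * t by rewrite mulr_ge0.
have pd : delta <= p by lra.
apply: (le_trans pd); have := p_le; have := n_ge2; have := p_gt0; nra.
Qed.

Lemma sqr_sum_abs_le (z : 'I_n -> R) : (\sum_i `|z i|) ^+ 2 <= n%:R * \sum_i z i ^+ 2.
Proof.
pose a : 'rV[R]_n := \row_i `|z i|; pose b : 'rV[R]_n := \row_i 1.
have ab : dotp a b = \sum_i `|z i| by apply: eq_bigr => i _; rewrite !mxE mulr1.
have aa : dotp a a = \sum_i z i ^+ 2.
  by apply: eq_bigr => i _; rewrite !mxE -expr2 real_normK ?num_real.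
have bb : dotp b b = n%:R.
  by rewrite /dotp (eq_bigr (fun=> 1)) ?sumr_const ?card_ord// => i _; rewrite !mxE mulr1.
rewrite -ab -aa -bb -!sqr_enorm -exprMn ler_sqr ?nnegrE ?mulr_ge0 ?enorm_ge0//.
  by rewrite mulrC; exact: CauchySchwarz.
by rewrite ab; apply: sumr_ge0.
Qed.

(** In the unknowns [z] the row is [e_j] up to entries of size [t], so the form is [z j + rho] with
    [|rho|] at most [t] times the sum of the [|z i|]; the square [rho^2] is dropped. *)
Lemma near_ray_form m x j (k : 'I_m) (z : 'I_n -> R) : k \in near_ray m j ->
  (forall i, z i = x ord0 i / enorm (v i)) ->
  z j ^+ 2 - 2 * t * `|z j| * \sum_i `|z i| <= dotp (coord (u k)) x ^+ 2.
Proof.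
move=> /near_rayP kj zE.
pose r i := coord (u k) ord0 i * enorm (v i) - (i == j)%:R.
have E : dotp (coord (u k)) x = z j + \sum_i r i * z i.
  rewrite /dotp -[z j]mul1r.
  have -> : 1 * z j = \sum_i (i == j)%:R * z i.
    by rewrite (bigD1 j)//= eqxx big1 ?addr0// => i /negPf ->; rewrite mul0r.
  rewrite -big_split/=; apply: eq_bigr => i _; rewrite -mulrDl /r addrC subrK zE.
  by rewrite mulrAC mulrA divfK ?gt_eqF ?enorm_v_gt0.
have rz : `|\sum_i r i * z i| <= t * \sum_i `|z i|.
  rewrite mulr_sumr; apply: le_trans (ler_norm_sum _ _ _) _; apply: ler_sum => i _.
  by rewrite normrM ler_wpM2r// kj.
rewrite E; set rho := \sum_i r i * z i in rz *; set Z := \sum_i `|z i| in rz *.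
have h1 : - (z j * rho) <= `|z j| * (t * Z).
  apply: le_trans (ler_norm _) _; rewrite normrN normrM ler_wpM2l//.
have := sqr_ge0 rho; nra.
Qed.

Lemma coercive m x : (N <= m)%N ->
  m%:R * (delta / vmax) * dotp x x <= \sum_(k < m) dotp (coord (u k)) x ^+ 2.
Proof.
move=> Nm; pose z i := x ord0 i / enorm (v i).
pose Z1 := \sum_i `|z i|; pose Z2 := \sum_i z i ^+ 2.
(* Group sizes are only bounded below, so the bound must be truncated at 0 before it is multiplied
   by them. *)
pose q j := Num.max 0 (z j ^+ 2 - 2 * t * `|z j| * Z1).
have Z20 : 0 <= Z2 by apply: sumr_ge0 => i _; exact: sqr_ge0.
apply: le_trans (sum_near_ray (fun k => sqr_ge0 _)).
apply: (@le_trans _ _ (m%:R * p * \sum_j q j)); last first.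
  rewrite mulr_sumr; apply: ler_sum => j _.
  apply: (@le_trans _ _ (\sum_(k in near_ray m j) q j)).
    rewrite sumr_const -[leRHS]mulr_natl ler_wpM2r ?card_near_ray//.
    by rewrite le_max lexx.
  apply: ler_sum => k kj; rewrite ge_max sqr_ge0/=; exact: (near_ray_form kj).
apply: (@le_trans _ _ (m%:R * p * (Z2 - 2 * t * Z1 ^+ 2))); last first.
  rewrite ler_wpM2l ?mulr_ge0 ?(ltW p_gt0)//.
  have -> : Z2 - 2 * t * Z1 ^+ 2 = \sum_j (z j ^+ 2 - 2 * t * `|z j| * Z1).
    by rewrite sumrB -mulr_suml -mulr_sumr expr2 mulrA.
  by apply: ler_sum => j _; rewrite le_max lexx orbT.
have Z12 := sqr_sum_abs_le z.
have xz : dotp x x <= vmax * Z2.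
  rewrite /Z2 mulr_sumr; apply: ler_sum => i _; rewrite /z exprMn exprVn mulrCA.
  by rewrite -expr2 ler_peMr ?sqr_ge0// ler_pdivlMr ?exprn_gt0 ?enorm_v_gt0// mul1r vmax_ge.
have dv : delta / vmax * dotp x x <= delta * Z2.
  rewrite -mulrA ler_wpM2l ?(ltW delta0)// mulrC ler_pdivrMr ?vmax_gt0//.
  by rewrite mulrC.
rewrite -mulrA -[leRHS]mulrA ler_wpM2l//; apply: (le_trans dv).
have n2 := n_ge2; have pl := p_le; have pg := p_gt0; set tau := n%:R * t.
have tau0 : 0 <= tau by rewrite mulr_ge0.
have pE : p = 5 / 2 * tau + delta by rewrite /tau mulrA.
have p2 : 5 / 2 * tau + delta <= 1 / 2 by rewrite -pE; nra.
apply: (@le_trans _ _ (p * (Z2 * (1 - 2 * tau)))).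
  by rewrite mulrCA [leLHS]mulrC ler_wpM2l// pE; nra.
rewrite ler_wpM2l ?(ltW pg)//.
have : t * Z1 ^+ 2 <= t * (n%:R * Z2) by rewrite ler_wpM2l.
rewrite mulrA [t * n%:R]mulrC -/tau; lra.
Qed.

(** The deficit [c^2 - [u]_j^2] is never negative, and a direction near one of the [n - 1] other
    rays has [[u]_j^2 <= t^2 / vmin]. Each such ray has at least [m p] directions, which produces
    [lambda]. *)
Lemma variance_le m j : (N <= m)%N ->
  \sum_(k < m) coord (u k) ord0 j ^+ 2 <= m%:R * lambda.
Proof.
move=> Nm; have c0 := ltW cDelta_gt0.
have cu k : 0 <= c ^+ 2 - coord (u k) ord0 j ^+ 2.
  have [ge0 _ _] := coordP fanP (u k).
  by rewrite subr_ge0 ler_sqr ?nnegrE//; exact: coord_le_cDelta.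
have gap : 0 <= c ^+ 2 - t ^+ 2 / vmin.
  rewrite subr_ge0 ler_pdivrMr ?vmin_gt0//.
  have := vmin_ge; rewrite -[_ ^- 2]mul1r ler_pdivrMr ?exprn_gt0 ?cDelta_gt0// => h.
  rewrite mulrC; apply: le_trans h; rewrite -[leRHS](expr1n _ 2) ler_sqr ?nnegrE//; have := t_half; lra.
have near i (k : 'I_m) : i != j -> k \in near_ray m i ->
    c ^+ 2 - t ^+ 2 / vmin <= c ^+ 2 - coord (u k) ord0 j ^+ 2.
  move=> ij /near_rayP /(_ j); rewrite eq_sym (negPf ij) subr0 => h.
  rewrite lerD2l lerN2 ler_pdivlMr ?vmin_gt0//.
  apply: (@le_trans _ _ (coord (u k) ord0 j ^+ 2 * enorm (v j) ^+ 2)).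
    by rewrite ler_wpM2l ?sqr_ge0// vmin_le.
  rewrite -exprMn -real_normK ?num_real// ler_sqr ?nnegrE//.
have key : m%:R * ((c ^+ 2 - t ^+ 2 / vmin) * (n%:R - 1) * p) <=
    \sum_(k < m) (c ^+ 2 - coord (u k) ord0 j ^+ 2).
  apply: le_trans (sum_near_ray (fun k => cu k)); rewrite (bigD1 j)//=.
  apply: (@le_trans _ _ (\sum_(i | i != j) (m%:R * p) * (c ^+ 2 - t ^+ 2 / vmin))).
    rewrite sumr_const cardC1 card_ord -[leRHS]mulr_natl -subn1 natrB; last first.
      by apply: ltnW; exact: (fan_two_rays fanP (design_neq0 0%N)).
    by rewrite le_eqVlt; apply/orP; left; apply/eqP; ring.
  rewrite ler_wpDl//; first by apply: sumr_ge0.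
  apply: ler_sum => i ij.
  apply: (@le_trans _ _ (\sum_(k in near_ray m i) (c ^+ 2 - t ^+ 2 / vmin))).
    by rewrite sumr_const -[leRHS]mulr_natl ler_wpM2r// card_near_ray.
  by apply: ler_sum => k; exact: near.
move: key; rewrite sumrB sumr_const card_ord -mulr_natl mulrBr; lra.
Qed.

(** At [e_j], coercivity bounds from below the very sum that [variance_le] bounds from above. *)
Lemma lambda_gt0 : 0 < lambda.
Proof.
have [j _] := some_index.
have := variance_le j (leqnn N); have := coercive (delta_mx ord0 j) (leqnn N).
have N0' : 0 < N%:R :> R by rewrite ltr0n.
under eq_bigr do rewrite dotpC dotp_delta.
rewrite dotp_delta mxE !eqxx mulr1 => h1 h2.
rewrite -(pmulr_rgt0 _ N0'); apply: lt_le_trans h2; apply: lt_le_trans h1.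
by rewrite mulr_gt0// divr_gt0// vmax_gt0.
Qed.

End Design.

(** * Existence, uniqueness and deterministic error *)

Section Estimator.
Context {R : realType} {d n : nat} (v : 'I_n -> 'rV[R]_d) (Delta : {set {set 'I_n}}).
Context (fanP : simplicial_polytopal_fan v Delta).
Local Notation coord := (Defs.coord v Delta).
Local Notation c := (cDelta v Delta).

(** All pairs of vectors are used instead of a finite list of wall-crossing inequalities; least
    squares only asks for an intersection of half-spaces. *)
Definition sublinearity_constraints : set ('rV[R]_n * R) :=
  [set a | exists x y, a = (coord (x + y) - coord x - coord y, 0)].

Definition support_vector (Q : set 'rV[R]_d) : 'rV[R]_n := \row_i hsupp Q (v i).

Lemma support_vector_feasible Q : in_defcone v Delta Q ->
  halfspaces sublinearity_constraints (support_vector Q).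
Proof.
move=> QD _ [x [y ->]] /=; rewrite !dotpBl.
by have := defcone_sublinear fanP x y QD; rewrite /=; lra.
Qed.

Lemma feasible_support_vector h : halfspaces sublinearity_constraints h ->
  exists2 Q, in_defcone v Delta Q & support_vector Q = h.
Proof.
move=> Fh; have [|Q QD Qh] := @defcone_realize R d n v Delta fanP h.
  move=> x y; have := Fh (coord (x + y) - coord x - coord y, 0).
  by rewrite /= !dotpBl => /(_ (ex_intro _ x (ex_intro _ y erefl))); lra.
by exists Q => //; apply/rowP => i; rewrite mxE Qh.
Qed.

Lemma support_vector_inj Q Q' : in_defcone v Delta Q -> in_defcone v Delta Q' ->
  support_vector Q = support_vector Q' -> Q = Q'.
Proof.
move=> QD QD' /rowP E; apply: (defcone_inj fanP QD QD') => i.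
by have := E i; rewrite !mxE.
Qed.

Context (u : nat -> 'rV[R]_d) (y : nat -> R) (m : nat) (alpha : R).
Context (m0 : (0 < m)%N) (alpha0 : 0 < alpha).
Context (coercive : forall x,
  alpha * dotp x x <= \sum_(k < m) dotp (coord (u k)) x ^+ 2).
Local Notation res := (residual (fun k : 'I_m => coord (u k)) (fun k : 'I_m => y k)).

Lemma lsq_objE Q : in_defcone v Delta Q ->
  lsq_obj u y m Q = m%:R^-1 * res (support_vector Q).
Proof.
by move=> QD; congr (_ * _); apply: eq_bigr => k _; rewrite (defcone_hsupp fanP).
Qed.

Lemma lsq_obj_le Q Q' : in_defcone v Delta Q -> in_defcone v Delta Q' ->
  (lsq_obj u y m Q <= lsq_obj u y m Q') = (res (support_vector Q) <= res (support_vector Q')).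
Proof. by move=> QD QD'; rewrite !lsq_objE// ler_pM2l// invr_gt0 ltr0n. Qed.

(** Every feasible vector is a support vector, so a minimizer among polytopes minimizes over the
    whole intersection of half-spaces. *)
Lemma LSE_variational Q Q' : LSE v Delta u y m Q -> in_defcone v Delta Q' ->
  \sum_(k < m) dotp (coord (u k)) (support_vector Q' - support_vector Q) ^+ 2 <=
  res (support_vector Q') - res (support_vector Q).
Proof.
move=> [QD Qm] QD'; apply: (residual_variational (support_vector_feasible QD)).
  by move=> z /feasible_support_vector[P PD <-]; rewrite -lsq_obj_le//; exact: Qm.
exact: support_vector_feasible.
Qed.

Lemma LSE_unique P : in_defcone v Delta P -> exists Q, LSE v Delta u y m = [set Q].
Proof.
move=> PD.
have [|h Fh hm] := @residual_min R n m (fun k => coord (u k)) (fun k => y k)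
    sublinearity_constraints alpha alpha0 coercive.
  by exists (support_vector P); exact: support_vector_feasible.
have [Q QD Qh] := feasible_support_vector Fh.
have QL : LSE v Delta u y m Q.
  split=> // Q' QD'; rewrite lsq_obj_le// Qh; apply: hm.
  exact: support_vector_feasible.
exists Q; apply/seteqP; split=> [Q' Q'L /=|_ -> //].
apply: (support_vector_inj Q'L.1 QD); apply/esym/eqP; rewrite -subr_eq0; apply/eqP/dotp_eq0.
apply/eqP; rewrite eq_le dotp_ge0 andbT -(pmulr_rle0 _ alpha0).
apply: (le_trans (coercive _)); apply: (le_trans (LSE_variational Q'L QD)).
by rewrite subr_le0 -lsq_obj_le//; [exact: QL.2 Q'L.1|exact: Q'L.1].
Qed.

(* With [y = A h_P + eps], the variational inequality at the estimator [h_Q]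
   reads [|A e|^2 <= <A e, eps> = <e, A^T eps>] for [e = h_Q - h_P]. *)
Lemma LSE_error (P Q : set 'rV[R]_d) (eps : nat -> R) :
  in_defcone v Delta P -> (forall k, y k = hsupp P (u k) + eps k) ->
  LSE v Delta u y m Q ->
  alpha * enorm (support_vector Q - support_vector P) <=
    enorm (\row_j \sum_(k < m) coord (u k) ord0 j * eps k).
Proof.
move=> PD yE QL; set X := \row_j _; set e := support_vector Q - support_vector P.
have := LSE_variational QL PD.
have -> : \sum_(k < m) dotp (coord (u k)) (support_vector P - support_vector Q) ^+ 2 =
    \sum_(k < m) dotp (coord (u k)) e ^+ 2.
  by apply: eq_bigr => k _; rewrite -opprB dotpNr sqrrN.
(* The residual vector is [- eps] at [P] and [A e - eps] at [Q]. The term [|A e|^2] gained here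
   doubles the left side and so cancels the factor 2. *)
have -> : res (support_vector P) - res (support_vector Q) =
    2 * dotp e X - \sum_(k < m) dotp (coord (u k)) e ^+ 2.
  have -> : dotp e X = \sum_(k < m) dotp (coord (u k)) e * eps k.
    have XE j : X ord0 j = \sum_(k < m) coord (u k) ord0 j * eps k by rewrite mxE.
    rewrite /dotp; under eq_bigr do rewrite XE mulr_sumr.
    rewrite exchange_big/=; apply: eq_bigr => k _; rewrite mulr_suml.
    by apply: eq_bigr => j _; rewrite mulrCA mulrA.
  rewrite mulr_sumr /residual -!sumrB; apply: eq_bigr => k _.
  rewrite yE (defcone_hsupp fanP _ PD) -/(support_vector P) /e dotpBr; ring.
move=> h; have {}h : alpha * dotp e e <= dotp e X.
  by apply: (le_trans (coercive e)); lra.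
have [e0|e0] := eqVneq e 0; first by rewrite e0 {1}/enorm dotp0l sqrtr0 mulr0 enorm_ge0.
rewrite -(ler_pM2r (enorm_gt0 e0)) -mulrA -expr2 sqr_enorm.
by apply: (le_trans h); rewrite mulrC; exact: CauchySchwarz.
Qed.

Lemma defcone_dH_le (P Q : set 'rV[R]_d) : 0 <= c ->
  in_defcone v Delta P -> in_defcone v Delta Q ->
  dH Q P <= Num.sqrt d%:R * c * enorm (support_vector Q - support_vector P).
Proof.
move=> c0 PD QD; apply: dH_le; [exact: QD.1|exact: PD.1|by rewrite !mulr_ge0 ?sqrtr_ge0 ?enorm_ge0|].
move=> w; rewrite !(defcone_hsupp fanP w)// -/(support_vector P) -/(support_vector Q) -dotpBr.
set e := _ - _.
have H : enorm (coord w) * enorm e <= Num.sqrt d%:R * c * enorm e * enorm w.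
  by rewrite mulrAC ler_wpM2r ?enorm_ge0//; exact: enorm_coord_le.
rewrite ler_norml; apply/andP; split; last exact: le_trans (CauchySchwarz _ _) H.
rewrite lerNl -dotpNr; apply: le_trans (CauchySchwarz _ _) _.
by rewrite -scaleN1r enormZ normrN1 mul1r.
Qed.

End Estimator.

Lemma enorm_lt_coord {R : realType} {n : nat} (X : 'rV[R]_n) (s : R) :
  (0 < n)%N -> (forall j, `|X ord0 j| < s) -> enorm X < Num.sqrt n%:R * s.
Proof.
move=> n0 Xs; have s0 : 0 < s by exact: le_lt_trans (normr_ge0 _) (Xs (Ordinal n0)).
rewrite -ltr_sqr ?nnegrE ?mulr_ge0 ?sqrtr_ge0 ?enorm_ge0 ?(ltW s0)//.
rewrite sqr_enorm exprMn sqr_sqrtr// -[n in n%:R]card_ord mulr_natl -sumr_const.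
have Xs2 j : X ord0 j * X ord0 j < s ^+ 2.
  by rewrite -expr2 -real_normK ?num_real// ltr_sqr ?nnegrE ?(ltW s0).
rewrite /dotp (bigD1 (Ordinal n0))//= [ltRHS](bigD1 (Ordinal n0))//=.
by rewrite ltr_leD// ler_sum// => j _; exact: ltW.
Qed.

(** Borel-Cantelli for countably many sequences at once: one negligible set serves every [l], as
    needed to quantify over all [e > 0] inside the almost sure statement. *)
Lemma almost_surely_eventually (R : realType) dd (Omega : measurableType dd)
    (Pr : probability Omega R) (F : nat -> nat -> set Omega) :
  (forall l m, measurable (F l m)) ->
  (forall l, (\sum_(m <oo) Pr (F l m) < +oo)%E) ->
  {ae Pr, forall w, forall l, exists M, forall m, (M <= m)%N -> ~ F l m w}.
Proof.
move=> mF sF.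
have mL l : measurable (lim_sup_set (F l)).
  by apply: bigcap_measurable => // k _; exact: bigcup_measurable.
have : Pr.-negligible (\bigcup_l lim_sup_set (F l)).
  by apply: negligible_bigcup => l; apply/negligibleP => //; exact: (lim_sup_set_cvg0 (mF l) (sF l)).
apply: negligibleS.
move=> w nw; apply: contrapT => nL; apply: nw => l; apply: contrapT => /forallNP no.
apply: nL; exists l => // M _; have := no M.
by move=> /existsNP[m /not_implyP[Mm /contrapT Fm]]; exists m.
Qed.

Lemma measure_bigsetU_le (R : realType) dd (Omega : measurableType dd)
    (mu : {measure set Omega -> \bar R}) (I : Type) (r : seq I) (B : I -> set Omega) :
  (forall i, measurable (B i)) ->
  (mu (\big[setU/set0]_(i <- r) B i) <= \sum_(i <- r) mu (B i))%E.
Proof.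
move=> mB; elim: r => [|i r IH]; first by rewrite !big_nil measure0.
rewrite !big_cons; apply: (le_trans (measureU2 _ (mB i) _)).
  by apply: bigsetU_measurable.
by rewrite leeD2l.
Qed.

Lemma nneseries_geometric_lty (R : realType) (a z : R) (f : nat -> \bar R) :
  0 <= a -> 0 < z < 1 -> (forall m, (0 <= f m)%E) ->
  (forall m, (f m <= (a * z ^+ m)%:E)%E) -> (\sum_(m <oo) f m < +oo)%E.
Proof.
move=> a0 /andP[z0 z1] f0 fz; apply: (@le_lt_trans _ _ (a * (1 - z)^-1)%:E); last exact: ltry.
apply: lime_le; first by apply: is_cvg_nneseries => m _ _; exact: f0.
apply: nearW => k; apply: (@le_trans _ _ (\sum_(0 <= i < k) (a * z ^+ i)%:E)%E).
  by apply: lee_sum => i _.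
rewrite sumEFin lee_fin; apply: geometric_le_lim => //.
by rewrite ger0_norm ?(ltW z0).
Qed.

(** * The noise event and its probability *)

Section NoiseEvent.
Context {R : realType} {d n : nat} (v : 'I_n -> 'rV[R]_d) (Delta : {set {set 'I_n}}).
Context (fanP : simplicial_polytopal_fan v Delta).
Context (u : nat -> 'rV[R]_d) (t delta : R) (N : nat).
Context (u1 : forall k, enorm (u k) = 1).
Context (t0 : 0 <= t) (t_half : t < 1 / 2) (delta0 : 0 < delta) (N0 : (0 < N)%N).
Local Notation p := (5 / 2 * n%:R * t + delta).
Context (countP : forall (m : nat) (i : 'I_n), (N <= m)%N ->
  m%:R * p <= (#|[set k : 'I_m | `[< Ct v Delta t i (u k) >]]|)%:R).
Context (dd : measure_display) (Omega : measurableType dd)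
  (Pr : probability Omega R) (eps : nat -> {RV Pr >-> R}).
Context (sigma : nat -> R) (gamma : R).
Context (sigma0 : forall k, 0 < sigma k) (sigma_le : forall k, sigma k ^+ 2 <= gamma).
Context (epsE : forall k (B : set R), measurable B ->
  distribution Pr (eps k) B = normal_prob 0 (sigma k) B).
Context (ind : mutually_independent eps).
Local Notation coord := (Defs.coord v Delta).
Local Notation c := (cDelta v Delta).
Local Notation vmax := (sup [set enorm (v i) ^+ 2 | i in [set: 'I_n]]).
Local Notation vmin := (inf [set enorm (v i) ^+ 2 | i in [set: 'I_n]]).
Local Notation lambda := (c ^+ 2 - (c ^+ 2 - t ^+ 2 / vmin) * (n%:R - 1) * p).

Lemma gamma_gt0 : 0 < gamma.
Proof. by apply: lt_le_trans (sigma_le 0%N); rewrite exprn_gt0. Qed.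

Definition noise (m : nat) (j : 'I_n) : Omega -> R :=
  weighted_noise eps m (fun k => coord (u k) ord0 j).

Definition large_noise (m : nat) (s : R) : set Omega :=
  \big[setU/set0]_(j < n) [set w | s <= `|noise m j w|].

Lemma measurable_noise_ge m s j : measurable [set w | s <= `|noise m j w|].
Proof.
rewrite (_ : [set _ | _] = (fun w => `|noise m j w|) @^-1` [set` `[s, +oo[]).
  rewrite -[X in measurable X]setTI.
  by apply: (measurableT_comp _ (measurable_weighted_noise eps m _)).
by apply/seteqP; split=> w /=; rewrite in_itv/= andbT.
Qed.

Lemma measurable_large_noise m s : measurable (large_noise m s).
Proof. by apply: bigsetU_measurable => j _; exact: measurable_noise_ge. Qed.

Lemma large_noise_prob m s : (N <= m)%N -> 0 < s ->
  (Pr (large_noise m s) <=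
   (2 * n%:R * expR (- (s ^+ 2 / (2 * (gamma * (m%:R * lambda))))))%:E)%E.
Proof.
move=> Nm s0; have m0 : 0 < m%:R :> R by rewrite ltr0n; exact: leq_trans Nm.
have l0 : 0 < lambda := lambda_gt0 fanP u1 t0 t_half delta0 N0 countP.
apply: (le_trans (measure_bigsetU_le _ _ (fun j => measurable_noise_ge m s j))).
set b := 2 * expR (- (s ^+ 2 / (2 * (gamma * (m%:R * lambda))))).
apply: (@le_trans _ _ (\sum_(j < n) b%:E)%E).
  apply: lee_sum => j _; apply: (weighted_noise_abs_tail sigma0 epsE ind) => //.
    by rewrite !mulr_gt0// gamma_gt0.
  apply: (@le_trans _ _ (\sum_(k < m) coord (u k) ord0 j ^+ 2 * gamma)).
    by apply: ler_sum => k _; rewrite ler_wpM2l ?sqr_ge0.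
  rewrite -mulr_suml mulrC ler_wpM2l ?(ltW gamma_gt0)//.
  exact: (variance_le fanP u1 t0 t_half countP j Nm).
by rewrite sumEFin sumr_const card_ord lee_fin -[leLHS]mulr_natl /b mulrCA mulrA.
Qed.

(** Strictness is what places the event [bound m eta <= dH Q P] inside [large_noise]. *)
Lemma estimator_error_lt (h0 : 'I_n -> R) (w : Omega) (m : nat) (s : R) Q :
  in_defcone v Delta (polyh v h0) -> (N <= m)%N ->
  LSE v Delta u (fun k => hsupp (polyh v h0) (u k) + eps k w) m Q ->
  ~ large_noise m s w ->
  dH Q (polyh v h0) < Num.sqrt d%:R * c * (Num.sqrt n%:R * s) / (m%:R * (delta / vmax)).
Proof.
move=> PD Nm QL good; have m0 : (0 < m)%N by exact: leq_trans Nm.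
have a0 : 0 < m%:R * (delta / vmax).
  by rewrite mulr_gt0 ?ltr0n// divr_gt0// (vmax_gt0 fanP u1).
have c0 := cDelta_gt0 fanP u1.
have d0 : (0 < d)%N.
  rewrite lt0n; apply: contraTneq isT => d0; have := u1 0%N.
  rewrite /enorm /dotp big1 ?sqrtr0 => [/eqP|i _]; first by rewrite eq_sym oner_eq0.
  by have := leq_trans (ltn_ord i) (eq_leq d0).
have err := LSE_error fanP m0 (fun x => coercive fanP u1 t0 t_half delta0 N0 countP x Nm)
  PD (fun k => erefl) QL.
have small j : `|noise m j w| < s.
  rewrite ltNge; apply/negP => sj; apply: good; rewrite /large_noise.
  by rewrite (bigD1 j)//=; left.
have n0 : (0 < n)%N by apply: ltnW; exact: (fan_two_rays fanP (design_neq0 u1 0%N)).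
apply: (le_lt_trans (defcone_dH_le fanP (ltW c0) PD QL.1)).
rewrite -[ltRHS]mulrA ltr_pM2l ?mulr_gt0 ?sqrtr_gt0 ?ltr0n// ltr_pdivlMr// mulrC.
apply: (le_lt_trans err); apply: enorm_lt_coord => // j.
by rewrite mxE; exact: small.
Qed.

End NoiseEvent.

(* All four square roots are kept as variables: the claim reduces to
   [sqrt a <= sqrt n * c], with [a = delta / vmax]. *)
Lemma rate_compare {R : realType} (sd sn sm sa sG c : R) :
  0 <= sd -> 0 < sn -> 0 < sm -> 0 < sa -> 0 <= sG -> 0 < c -> sa <= sn * c ->
  sd * c * (sn * (sm * sG)) / (sm ^+ 2 * sa ^+ 2) <=
  sm^-1 * (sn ^+ 2 * c ^+ 2 / (sa ^+ 2 * sa)) * (sd * sG).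
Proof.
move=> sd0 sn0 sm0 sa0 sG0 c0 h.
have -> : sm^-1 * (sn ^+ 2 * c ^+ 2 / (sa ^+ 2 * sa)) * (sd * sG) =
    sd * c * (sn * (sm * sG)) / (sm ^+ 2 * sa ^+ 2) * (sn * c / sa).
  by field; rewrite !gt_eqF.
rewrite ler_peMr//; last by rewrite ler_pdivlMr// mul1r.
by rewrite divr_ge0 ?mulr_ge0 ?exprn_ge0 ?mulr_ge0 ?(ltW c0) ?(ltW sn0) ?(ltW sm0) ?(ltW sa0).
Qed.

Theorem theorem4p2 (R : realType) (d n : nat) (v : 'I_n -> 'rV[R]_d)
  (Delta : {set {set 'I_n}}) (u : nat -> 'rV[R]_d) (t delta : R) (N : nat)
  (h0 : 'I_n -> R) (dd : measure_display) (Omega : measurableType dd)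
  (Pr : probability Omega R) (eps : nat -> {RV Pr >-> R})
  (sigma : nat -> R) (gamma : R) :
  simplicial_polytopal_fan v Delta ->
  (forall k, enorm (u k) = 1) ->
  0 <= t -> t < 1 / 2 -> 0 < delta -> (0 < N)%N ->
  (forall (m : nat) (i : 'I_n), (N <= m)%N ->
     m%:R * (5 / 2 * n%:R * t + delta)
       <= (#|[set k : 'I_m | `[< Ct v Delta t i (u k) >]]|)%:R) ->
  in_defcone v Delta (polyh v h0) ->
  (forall k, 0 < sigma k) -> (forall k, sigma k ^+ 2 <= gamma) ->
  (forall k (B : set R), measurable B ->
     distribution Pr (eps k) B = normal_prob 0 (sigma k) B) ->
  mutually_independent eps ->
  let P := polyh v h0 in
  let y := fun (w : Omega) (k : nat) => hsupp P (u k) + eps k w in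
  let c := cDelta v Delta in
  let vmax := sup [set enorm (v i) ^+ 2 | i in [set: 'I_n]] in
  let vmin := inf [set enorm (v i) ^+ 2 | i in [set: 'I_n]] in
  let kappa := powR (delta / vmax) (3 / 2) in
  let lambda := c ^+ 2 - (c ^+ 2 - t ^+ 2 / vmin) * (n%:R - 1)
                          * (5 / 2 * n%:R * t + delta) in
  let bound := fun (m : nat) (eta : R) =>
    (Num.sqrt m%:R)^-1 * (n%:R * c ^+ 2 / kappa)
      * Num.sqrt (2 * d%:R * gamma * lambda * ln (2 * n%:R / eta)) in
  [/\ (forall (w : Omega) (m : nat), (N <= m)%N ->
          exists Q, LSE v Delta u (y w) m = [set Q]),
      {ae Pr, forall w, forall e : R, 0 < e -> exists M : nat,
          forall m : nat, (M <= m)%N -> forall Q,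
            LSE v Delta u (y w) m Q -> dH Q P < e} &
      (forall (m : nat) (eta : R), (N <= m)%N -> 0 < eta -> eta < 1 ->
          exists A : set Omega, [/\ measurable A,
            [set w | exists Q, LSE v Delta u (y w) m Q /\ bound m eta <= dH Q P]
              `<=` A & (Pr A <= eta%:E)%E])].
Proof.
move=> fanP u1 t0 t_half delta0 N0 countP PD sigma0 sigma_le epsE ind.
move=> P y c vmax vmin kappa lambda bound.
have c0 : 0 < c := cDelta_gt0 fanP u1.
have vmax0 : 0 < vmax := vmax_gt0 fanP u1.
have lambda0 : 0 < lambda := lambda_gt0 fanP u1 t0 t_half delta0 N0 countP.
have gamma0 : 0 < gamma := gamma_gt0 sigma0 sigma_le.
have n2 : 2 <= n%:R :> R := n_ge2 fanP u1.
have n0 : 0 < n%:R :> R by apply: lt_le_trans n2.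
have pos m : (N <= m)%N -> 0 < m%:R :> R.
  by move=> Nm; rewrite ltr0n; exact: leq_trans Nm.
pose a := delta / vmax; have a0 : 0 < a by rewrite divr_gt0.
split.
- move=> w m Nm; have m0 : (0 < m)%N by exact: leq_trans Nm.
  have ma0 : 0 < m%:R * a by rewrite mulr_gt0 ?pos.
  exact: (LSE_unique fanP (y w) m0 ma0
    (fun x => coercive fanP u1 t0 t_half delta0 N0 countP x Nm) PD).
- pose tau (l : nat) : R := l.+1%:R^-1.
  have tau0 l : 0 < tau l by rewrite invr_gt0.
  (* A level linear in [m] keeps the error below a fixed multiple of [tau l], while the tail decays
     geometrically in [m]. The tail bound starts at [N], hence [set0] before. *)
  pose F l m := if (N <= m)%N then large_noise v Delta u eps m (m%:R * tau l) else set0.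
  have mF l m : measurable (F l m).
    by rewrite /F; case: ifP => _ //; exact: measurable_large_noise.
  have sF l : (\sum_(m <oo) Pr (F l m) < +oo)%E.
    pose beta := tau l ^+ 2 / (2 * (gamma * lambda)).
    have beta0 : 0 < beta by rewrite divr_gt0 ?exprn_gt0// !mulr_gt0.
    apply: (@nneseries_geometric_lty _ (2 * n%:R) (expR (- beta))).
    + by rewrite mulr_ge0.
    + by rewrite expR_gt0/= -[ltRHS]expR0 ltr_expR oppr_lt0.
    + by move=> m; exact: measure_ge0.
    + move=> m; rewrite /F; case: ifP => [Nm|_]; last first.
        by rewrite measure0 lee_fin !mulr_ge0// exprn_ge0// expR_ge0.
      have m0 := pos _ Nm.
      apply: le_trans (large_noise_prob fanP u1 t0 t_half delta0 N0 countP sigma0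
        sigma_le epsE ind Nm _) _; first by rewrite mulr_gt0.
      rewrite lee_fin -expRM_natl le_eqVlt; apply/orP; left; apply/eqP.
      congr (_ * expR _); rewrite -/lambda /beta; field.
      by rewrite !gt_eqF.
  apply: filterS (almost_surely_eventually mF sF) => w ev e e0.
  pose K := Num.sqrt d%:R * c * Num.sqrt n%:R / a.
  (* This [l] gives [K / (l + 1) < e]. *)
  have [M MP] := ev (Num.truncn (K / e)).
  exists (maxn M N) => m; rewrite geq_max => /andP[Mm Nm] Q QL.
  have m0 := pos _ Nm; have := MP m Mm; rewrite /F Nm => good.
  apply: (lt_trans (estimator_error_lt fanP u1 t0 t_half delta0 N0 countP PD Nm QL good)).
  rewrite -/a -/c (_ : _ / _ = K * tau (Num.truncn (K / e))); last first.
    by rewrite /K /tau; field; rewrite !gt_eqF.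
  by rewrite ltr_pdivrMr// mulrC -ltr_pdivrMr// truncnS_gt.
- move=> m eta Nm eta0 eta1; have m0 := pos _ Nm.
  pose L := ln (2 * n%:R / eta).
  have arg1 : 1 < 2 * n%:R / eta by rewrite ltr_pdivlMr// mul1r; lra.
  have L0 : 0 < L by rewrite ln_gt0.
  (* Chosen so that the tail exponent equals [L], whence the union bound is
     [2 n * eta / (2 n) = eta]. *)
  pose s := Num.sqrt (2 * (gamma * (m%:R * lambda)) * L).
  have s0 : 0 < s by rewrite sqrtr_gt0 !mulr_gt0.
  exists (large_noise v Delta u eps m s); split.
  + exact: measurable_large_noise.
  + move=> w /= [Q [QL bQ]]; apply: contrapT => good.
    have := estimator_error_lt fanP u1 t0 t_half delta0 N0 countP PD Nm QL good.
    rewrite ltNge => /negP; apply; apply: le_trans bQ.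
    have G0 : 0 <= 2 * gamma * lambda * L by rewrite !mulr_ge0// ltW.
    have -> : s = Num.sqrt m%:R * Num.sqrt (2 * gamma * lambda * L).
      by rewrite -sqrtrM ?ler0n//; congr Num.sqrt; ring.
    rewrite /bound -/L.
    have -> : Num.sqrt (2 * d%:R * gamma * lambda * L) =
        Num.sqrt d%:R * Num.sqrt (2 * gamma * lambda * L).
      by rewrite -sqrtrM ?ler0n//; congr Num.sqrt; ring.
    have -> : kappa = Num.sqrt a ^+ 2 * Num.sqrt a.
      rewrite sqr_sqrtr ?(ltW a0)// -powR12_sqrt ?(ltW a0)// /kappa -/a.
      rewrite (_ : 3 / 2 = 1 + 2^-1); last by field.
      by rewrite powRD ?powRr1 ?(ltW a0)// (gt_eqF a0) implybT.
    have := @rate_compare R (Num.sqrt d%:R) (Num.sqrt n%:R) (Num.sqrt m%:R)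
      (Num.sqrt a) (Num.sqrt (2 * gamma * lambda * L)) c.
    rewrite !sqr_sqrtr ?ler0n ?(ltW a0)//; apply; rewrite ?sqrtr_ge0 ?sqrtr_gt0//.
    have [i _] := some_index fanP u1.
    (* From [delta <= 1 <= c^2 |v_i|^2 <= c^2 vmax]. *)
    have ac : Num.sqrt a <= c.
      rewrite -[leRHS]ger0_norm ?(ltW c0)// -sqrtr_sqr ler_wsqrtr// ler_pdivrMr//.
      apply: (le_trans (delta_le1 fanP u1 t0 t_half delta0 N0 countP)).
      apply: (le_trans (sqr_cDelta_ge fanP u1 i)).
      by rewrite ler_wpM2l ?sqr_ge0//; exact: vmax_ge.
    apply: (le_trans ac); rewrite ler_peMl ?(ltW c0)//.
    by rewrite -[leLHS]sqrtr1 ler_wsqrtr//; lra.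
  + apply: le_trans (large_noise_prob fanP u1 t0 t_half delta0 N0 countP sigma0
      sigma_le epsE ind Nm s0) _.
    rewrite lee_fin sqr_sqrtr; last by rewrite !mulr_ge0 ?(ltW gamma0) ?(ltW m0) ?(ltW lambda0) ?(ltW L0).
    rewrite -/lambda (_ : _ * L / _ = L); last first.
      by rewrite mulrAC divff ?mul1r// gt_eqF// !mulr_gt0.
    rewrite expRN lnK ?posrE; last by apply: lt_trans arg1.
    by rewrite invf_div mulrCA divff ?mulr1// gt_eqF// mulr_gt0.
Qed.
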